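(* Let $h:\mathbb{N}\to(0,\infty)$ be a growth function and $(H_0,H_1)=(\ell^2,\ell^2_h)$. Suppose that $\mathfrak{a}$ and $\mathfrak{b}$ are shift-invariant growth types. Then $\mathcal{F}_h^{\mathfrak{a}\mathfrak{b}}$ is open and closed in the space $\mathcal{F}_h$ of weak Hessians of Floer type.
   Context: $\mathbb{N}=\{1,2,\dots\}$. A growth function is a monotone (nondecreasing) unbounded function $f:\mathbb{N}\to(0,\infty)$. Two growth functions $f,g$ have the same growth type, $f\sim g$, if there is $c>0$ with $\frac1c g(\nu)\le f(\nu)\le c\,g(\nu)$ for all $\nu$. The equivalence classes $[f]$ are called growth types; $\mathfrak{G}$ is the set of growth types. The shift of $f$ is $f_1(\nu):=f(\nu+1)$; a growth type $[f]$ is shift-invariant if $f\sim f_1$; $\mathfrak{G}_1\subset\mathfrak{G}$ is the set of shift-invariant growth types. For a growth function $f$ and $r\in\mathbb{R}$, $\ell^2_{f^r}$ is the Hilbert space of real sequences $x=(x_\nu)_{\nu\in\mathbb{N}}$ with $\sum_\nu f(\nu)^r x_\nu^2<\infty$, with inner product $\langle x,y\rangle=\sum_\nu f(\nu)^r x_\nu y_\nu$. Given $h$, put $H_r:=\ell^2_{h^r}$; for $s<r$ the inclusion $H_r\subset H_s$ is compact and dense. Let $\iota$ denote the inclusion $H_1\hookrightarrow H_0$. The space of weak Hessians $\mathcal{H}_h\subset\mathcal{L}(H_1,H_0)\cap\mathcal{L}(H_2,H_1)$ consists of all bounded linear maps $A:H_1\to H_0$ which are Fredholm of index zero, $H_0$-symmetric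 ($\langle Ax,y\rangle_0=\langle x,Ay\rangle_0$ for all $x,y\in H_1$), and which restrict to a bounded linear map $H_2\to H_1$ that is also Fredholm of index zero. It carries the subspace topology from the norm $\max\{\|\cdot\|_{\mathcal{L}(H_1,H_0)},\|\cdot\|_{\mathcal{L}(H_2,H_1)}\}$. The spectrum $\operatorname{spec}A$ (the set of real $\lambda$ for which $A-\lambda\iota$ is not an isomorphism) of $A\in\mathcal{H}_h$ consists of discrete real eigenvalues of finite multiplicity, and there is an orthonormal basis of $H_0$ of eigenvectors of $A$ in $H_1$. $\mathcal{F}_h\subset\mathcal{H}_h$ denotes the subset of Floer type weak Hessians, i.e. those with infinitely many positive and infinitely many negative eigenvalues, and $\mathcal{F}_h^*\subset\mathcal{F}_h$ the subset of invertible ones. For $A\in\mathcal{F}_h^*$, the positive growth function $f_A^+:\mathbb{N}\to(0,\infty)$ lists the positive eigenvalues of $A$ with multiplicities in increasing order; the negative growth function $f_A^-$ lists in the same way the absolute values of the negative eigenvalues. For $\lambda\in\mathbb{R}$ write $\mathbb{A}_\lambda:=A-\lambda\iota\in\mathcal{F}_h$. For $\mathfrak{a},\mathfrak{b}\in\mathfrak{G}_1$, $$\mathcal{F}_h^{\mathfrak{a}\mathfrak{b}}:=\{A\in\mathcal{F}_h\mid \forall\lambda\in\mathbb{R}\setminus\operatorname{spec}A:\ [f^-_{\mathbb{A}_\lambda}]=\mathfrak{a}\ \text{and}\ [f^+_{\mathbb{A}_\lambda}]=\mathfrak{b}\}.$$ *)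

(* Defs.v *)
From HB Require Import structures.
From mathcomp Require Import all_boot all_order all_algebra.
From mathcomp Require Import all_classical all_reals all_analysis.
From mathcomp Require Import ring lra.

Set Implicit Arguments.
Unset Strict Implicit.
Unset Printing Implicit Defensive.

Import Order.TTheory GRing.Theory Num.Theory.
Import numFieldNormedType.Exports.

Local Open Scope classical_set_scope.
Local Open Scope ring_scope.

(* Sequences are indexed by nat: the index n stands for nu = n + 1. *)
Record growth (R : realType) := Growth {
  growth_fun :> nat -> R;
  growth_gt0 : forall n, 0 < growth_fun n;
  growth_homo : {homo growth_fun : m n / (m <= n)%N >-> m <= n};
  growth_unbounded : forall M : R, exists n, M < growth_fun n }.

Section GrowthTypes.
Variable R : realType.
Implicit Types f g : growth R.

Lemma shift_gt0 f n : 0 < f n.+1.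
Proof. exact: growth_gt0. Qed.

Lemma shift_homo f :
  {homo (fun n => f n.+1) : m n / (m <= n)%N >-> m <= n}.
Proof. by move=> m n mn; apply: growth_homo. Qed.

Lemma shift_unbounded f (M : R) : exists n, M < f n.+1.
Proof.
have [n Mn] := growth_unbounded f M; exists n.
by apply: lt_le_trans Mn _; apply: growth_homo.
Qed.

Definition shift f : growth R :=
  Growth (shift_gt0 f) (@shift_homo f) (shift_unbounded f).

Definition same_growth f g : Prop :=
  exists2 c : R, 0 < c & forall n, c^-1 * g n <= f n /\ f n <= c * g n.

(* A growth type is the set of all members of an equivalence class. *)
Definition growth_class f : set (growth R) := [set g | same_growth f g].

Definition growth_types : set (set (growth R)) := range growth_class.

Definition shift_invariant_growth_types : set (set (growth R)) :=
  [set growth_class f | f in [set f | same_growth f (shift f)]].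

End GrowthTypes.

Arguments growth_types : clear implicits.
Arguments shift_invariant_growth_types : clear implicits.

Lemma normM_le_sqrD (R : realType) (a b : R) : `|a * b| <= a ^+ 2 + b ^+ 2.
Proof.
have := sqr_ge0 (a - b); have := sqr_ge0 (a + b).
have := sqr_ge0 a; have := sqr_ge0 b.
by rewrite ler_norml => *; apply/andP; split; lra.
Qed.

Section WeightedL2.
Variables (R : realType) (h : growth R) (r : R).

Definition wt (n : nat) : R := h n `^ r.

Lemma wt_gt0 n : 0 < wt n.
Proof. exact/powR_gt0/growth_gt0. Qed.

Definition wl2_pred : pred (nat -> R^o) :=
  fun x => `[< cvgn (series (fun n => wt n * x n ^+ 2)) >].

Record wl2 := Wl2 { wl2_seq :> nat -> R^o; wl2_seqP : wl2_pred wl2_seq }.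

HB.instance Definition _ := [isSub for wl2_seq].
HB.instance Definition _ := [Choice of wl2 by <:].

Lemma wl2_dom (u v : nat -> R) : (forall n, `|u n| <= v n) ->
  cvgn (series v) -> cvgn (series u).
Proof.
move=> uv cv; apply: normed_cvg; apply: series_le_cvg cv => n /=;
  by rewrite ?normr_ge0// ?(le_trans _ (uv n)).
Qed.

Lemma wl2_submod : submod_closed (wl2_pred : pred (nat -> R^o)).
Proof.
split.
  apply/asboolP; rewrite (_ : series _ = cst 0); first exact: is_cvg_cst.
  apply/funext => n; rewrite /series /= big1// => i _.
  by rewrite (_ : (0 : nat -> R^o) i = 0)// expr0n mulr0.
move=> a x y /asboolP cx /asboolP cy; apply/asboolP.
have cz : cvgn (series (fun n =>
    (2 * a ^+ 2) * (wt n * x n ^+ 2) + 2 * (wt n * y n ^+ 2))).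
  apply: is_cvg_seriesD; first exact: (is_cvg_seriesZ (k := 2 * a ^+ 2)).
  exact: (is_cvg_seriesZ (k := 2)).
apply: wl2_dom cz => n.
rewrite (_ : (a *: x + y) n = a * x n + y n)//.
rewrite ger0_norm; last by rewrite mulr_ge0 ?sqr_ge0 ?ltW ?wt_gt0.
rewrite -subr_ge0 (_ : _ - _ = wt n * (a * x n - y n) ^+ 2); last by ring.
by rewrite mulr_ge0 ?sqr_ge0 ?ltW ?wt_gt0.
Qed.

HB.instance Definition _ :=
  GRing.isSubmodClosed.Build R (nat -> R^o) wl2_pred wl2_submod.
HB.instance Definition _ := [SubChoice_isSubLmodule of wl2 by <:].

Definition wl2_dot (x y : wl2) : R :=
  limn (series (fun n => wt n * (x n * y n))).

Definition wl2_norm (x : wl2) : R := Num.sqrt (wl2_dot x x).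

Lemma wl2_dot_cvg (x y : wl2) :
  cvgn (series (fun n => wt n * (x n * y n))).
Proof.
have /asboolP cx := wl2_seqP x; have /asboolP cy := wl2_seqP y.
have cz := is_cvg_seriesD cx cy; apply: wl2_dom cz => n /=.
have w0 := wt_gt0 n.
rewrite -[leRHS]mulrDr normrM (gtr0_norm w0) ler_pM2l//.
exact: (@normM_le_sqrD R (x n) (y n)).
Qed.

Lemma wl2_dotC x y : wl2_dot x y = wl2_dot y x.
Proof.
rewrite /wl2_dot; congr (limn (series _)).
by apply/funext => n; rewrite [x n * _]mulrC.
Qed.

Lemma wl2_dotDZl a x y z :
  wl2_dot (a *: x + y) z = a * wl2_dot x z + wl2_dot y z.
Proof.
rewrite /wl2_dot -[a * _](lim_seriesZ a); last exact: wl2_dot_cvg.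
rewrite -lim_seriesD; last exact: wl2_dot_cvg; last first.
  by apply: is_cvg_seriesZ; exact: wl2_dot_cvg.
congr (limn (series _)); apply/funext => n.
have E (w u v t : R) : w * ((a * u + v) * t) = a * (w * (u * t)) + w * (v * t).
  by ring.
exact: (E (wt n) (x n) (y n) (z n)).
Qed.

Lemma wl2_term_ge0 (x : wl2) n : 0 <= wt n * (x n * x n).
Proof.
have E (a : R) : 0 <= a * a by rewrite -expr2 sqr_ge0.
exact: mulr_ge0 (ltW (wt_gt0 n)) (E (x n)).
Qed.

Lemma wl2_dot_ge0 (x : wl2) : 0 <= wl2_dot x x.
Proof.
apply: limr_ge; first exact: wl2_dot_cvg.
by apply: nearW => n; apply: sumr_ge0 => i _; exact: wl2_term_ge0.
Qed.

Lemma wl2_dot_coord (x : wl2) n : wt n * x n ^+ 2 <= wl2_dot x x.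
Proof.
apply: limr_ge; first exact: wl2_dot_cvg.
exists n.+1 => // m /= nm.
rewrite /series /= (bigD1_seq n) ?mem_index_iota ?iota_uniq//=.
by rewrite -expr2 lerDl sumr_ge0// => i _; exact: wl2_term_ge0.
Qed.

Lemma wl2_CS x y : wl2_dot x y ^+ 2 <= wl2_dot x x * wl2_dot y y.
Proof.
set a := wl2_dot x x; set b := wl2_dot x y; set c := wl2_dot y y.
have a0 : 0 <= a := wl2_dot_ge0 x.
have c0 : 0 <= c := wl2_dot_ge0 y.
have q t : 0 <= t ^+ 2 * a + 2 * t * b + c.
  have := wl2_dot_ge0 (t *: x + y).
  rewrite wl2_dotDZl [wl2_dot x _]wl2_dotC [wl2_dot y _]wl2_dotC !wl2_dotDZl.
  rewrite -/a -/c [wl2_dot y x]wl2_dotC -/b.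
  by move: (a) (b) (c) => *; lra.
have [a00|an0] := eqVneq a 0.
  have := q (- (c + 1) * b / (2 * b ^+ 2)).
  have [->|b0] := eqVneq b 0; first by rewrite expr0n mulr_ge0.
  rewrite a00 mulr0 add0r => {}q; exfalso.
  suff : 2 * (- (c + 1) * b / (2 * b ^+ 2)) * b + c = -1.
    by move=> qE; rewrite qE in q; lra.
  by field; rewrite b0.
have {}a0 : 0 < a by rewrite lt_def an0.
have := q (- b / a).
rewrite (_ : _ + c = (a * c - b ^+ 2) / a); last by field.
by rewrite pmulr_lge0 ?invr_gt0// subr_ge0.
Qed.

Lemma wl2_normD x y : wl2_norm (x + y) <= wl2_norm x + wl2_norm y.
Proof.
rewrite /wl2_norm -(@ler_pXn2r _ 2)// ?nnegrE ?addr_ge0 ?sqrtr_ge0//.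
rewrite sqrrD !sqr_sqrtr ?wl2_dot_ge0//.
rewrite -[x in wl2_dot (x + _) _]scale1r wl2_dotDZl wl2_dotC.
rewrite [wl2_dot y _]wl2_dotC -[x in wl2_dot (x + _) _]scale1r.
rewrite -[x in wl2_dot (x + _) y]scale1r !wl2_dotDZl.
rewrite [wl2_dot y x]wl2_dotC.
have : wl2_dot x y <= Num.sqrt (wl2_dot x x) * Num.sqrt (wl2_dot y y).
  rewrite -sqrtrM ?wl2_dot_ge0//; apply: le_trans (ler_norm _) _.
  by rewrite -sqrtr_sqr ler_wsqrtr// wl2_CS.
rewrite mulr2n; move: (Num.sqrt _ * _) (wl2_dot _ _) => s.
move: (wl2_dot _ _) (wl2_dot _ _) => *; lra.
Qed.

Lemma wl2_normZ (l : R) x : wl2_norm (l *: x) = `|l| * wl2_norm x.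
Proof.
rewrite /wl2_norm -[l *: x]addr0 wl2_dotDZl wl2_dotC wl2_dotDZl.
have dot0 y : wl2_dot 0 y = 0.
  have := wl2_dotDZl 1 0 0 y; rewrite scaler0 addr0; lra.
by rewrite !dot0 !addr0 mulrA -expr2 sqrtrM ?sqr_ge0// sqrtr_sqr.
Qed.

Lemma wl2_norm0_eq0 x : wl2_norm x = 0 -> x = 0.
Proof.
move=> /eqP; rewrite sqrtr_eq0 => x0; apply/val_inj/funext => n /=.
have := wl2_dot_coord x n; move=> /le_trans/(_ x0).
rewrite pmulr_rle0 ?wt_gt0// => xn0; apply/eqP.
by rewrite -sqrf_eq0 eq_le xn0 sqr_ge0.
Qed.

HB.instance Definition _ :=
  Lmodule_isNormed.Build R wl2 wl2_normD wl2_normZ wl2_norm0_eq0.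

End WeightedL2.

Section BoundedOperators.
Variables (R : realType) (V W : normedModType R).

Definition bop_pred : pred (V -> W) :=
  fun f => `[< linear f /\ exists M : R, forall x, `|f x| <= M * `|x| >].

Record bop := Bop { bop_fun :> V -> W; bop_funP : bop_pred bop_fun }.

HB.instance Definition _ := [isSub for bop_fun].
HB.instance Definition _ := [Choice of bop by <:].

Lemma bop_submod : submod_closed (bop_pred : pred (V -> W)).
Proof.
split.
  apply/asboolP; split; first by move=> a x y; rewrite scaler0 addr0.
  by exists 0 => x; rewrite normr0 mul0r.
move=> a f g /asboolP[lf [M fM]] /asboolP[lg [N gN]]; apply/asboolP; split.
  move=> k x y.
  rewrite (_ : (a *: f + g) (k *: x + y)
    = a *: f (k *: x + y) + g (k *: x + y))// lf lg.
  rewrite (_ : (a *: f + g) x = a *: f x + g x)//.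
  rewrite (_ : (a *: f + g) y = a *: f y + g y)//.
  by rewrite !scalerDr !scalerA [a * k]mulrC -!addrA; congr (_ + _);
    rewrite addrCA.
exists (`|a| * M + N) => x; rewrite (_ : (a *: f + g) x = a *: f x + g x)//.
rewrite mulrDl (le_trans (ler_normD _ _))// lerD// normrZ -mulrA.
by rewrite ler_wpM2l.
Qed.

HB.instance Definition _ :=
  GRing.isSubmodClosed.Build R (V -> W) bop_pred bop_submod.
HB.instance Definition _ := [SubChoice_isSubLmodule of bop by <:].

Lemma bop_linear (T : bop) : linear T.
Proof. by have /asboolP[] := bop_funP T. Qed.

HB.instance Definition _ (T : bop) :=
  GRing.isLinear.Build R V W _ T (bop_linear T).

Definition opnorm (T : bop) : R := sup [set `|T x| | x in [set x | `|x| <= 1]].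

Lemma opnorm_has_sup (T : bop) :
  has_sup [set `|T x| | x in [set x | `|x| <= 1]].
Proof.
split; first by exists `|T 0|, 0 => //=; rewrite normr0.
have /asboolP[_ [M TM]] := bop_funP T.
exists `|M| => _ [x /= x1 <-]; apply: le_trans (TM x) _.
rewrite (le_trans (ler_norm _))// normrM normr_id.
by rewrite -[leRHS]mulr1 ler_wpM2l.
Qed.

Lemma opnorm_ub (T : bop) x : `|T x| <= opnorm T * `|x|.
Proof.
have [->|x0] := eqVneq x 0; first by rewrite linear0 !normr0 mulr0.
have nx0 : 0 < `|x| by rewrite normr_gt0.
rewrite -ler_pdivrMr// mulrC -[X in X * _]gtr0_norm ?invr_gt0// -normrZ -linearZ.
apply: ub_le_sup; first by case: (opnorm_has_sup T).
exists (`|x|^-1 *: x) => //=.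
by rewrite normrZ gtr0_norm ?invr_gt0// mulVf// gt_eqF.
Qed.

Lemma opnorm_ge0 (T : bop) : 0 <= opnorm T.
Proof.
apply: ub_le_sup; first by case: (opnorm_has_sup T).
by exists 0; rewrite /= ?linear0 normr0.
Qed.

Lemma opnorm_le (T : bop) (M : R) : 0 <= M ->
  (forall x, `|T x| <= M * `|x|) -> opnorm T <= M.
Proof.
move=> M0 TM; apply: ge_sup; first by case: (opnorm_has_sup T).
by move=> _ [x /= x1 <-]; rewrite (le_trans (TM x))// ler_piMr.
Qed.

Lemma opnormD (S T : bop) : opnorm (S + T) <= opnorm S + opnorm T.
Proof.
apply: opnorm_le; first by rewrite addr_ge0 ?opnorm_ge0.
move=> x; rewrite (_ : (S + T) x = S x + T x)// mulrDl.
by rewrite (le_trans (ler_normD _ _))// lerD ?opnorm_ub.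
Qed.

Lemma opnormZ_le (l : R) (T : bop) : opnorm (l *: T) <= `|l| * opnorm T.
Proof.
apply: opnorm_le; first by rewrite mulr_ge0 ?opnorm_ge0.
by move=> x; rewrite (_ : (l *: T) x = l *: T x)// normrZ -mulrA
  ler_wpM2l ?opnorm_ub.
Qed.

Lemma opnormZ (l : R) (T : bop) : opnorm (l *: T) = `|l| * opnorm T.
Proof.
have [->|l0] := eqVneq l 0.
  apply/eqP; rewrite normr0 mul0r eq_le opnorm_ge0 andbT.
  by have := opnormZ_le 0 T; rewrite normr0 mul0r.
apply/eqP; rewrite eq_le opnormZ_le /= -ler_pdivlMl ?normr_gt0//.
by rewrite -normfV (le_trans _ (opnormZ_le _ _))// scalerK.
Qed.

Lemma opnorm0_eq0 (T : bop) : opnorm T = 0 -> T = 0.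
Proof.
move=> T0; apply/val_inj/funext => x; apply/eqP.
by rewrite -normr_le0 (le_trans (opnorm_ub T x))// T0 mul0r.
Qed.

HB.instance Definition _ :=
  Lmodule_isNormed.Build R bop opnormD opnormZ opnorm0_eq0.


End BoundedOperators.

Section Fredholm.
Variables (R : realType) (V W : normedModType R).

Definition isomorphism (T : bop V W) : Prop :=
  exists S : bop W V, cancel T S /\ cancel S T.

(* dim S = n for a linear subspace S: S has a basis with n elements. *)
Definition has_dim (U : lmodType R) (S : set U) (n : nat) : Prop :=
  exists2 e : 'I_n -> U, (forall i, S (e i)) &
    forall x, S x -> exists! c : 'rV[R]_n, x = \sum_i c 0 i *: e i.

(* dim (U / S) = n: the classes of n vectors form a basis of U / S. *)
Definition has_codim (U : lmodType R) (S : set U) (n : nat) : Prop :=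
  exists e : 'I_n -> U,
    forall x, exists! c : 'rV[R]_n, S (x - \sum_i c 0 i *: e i).

Definition fredholm_index (T : bop V W) (k : int) : Prop :=
  exists m n : nat, [/\ has_dim [set x | T x = 0] m, closed (range T),
    has_codim (range T) n & k = m%:Z - n%:Z].

End Fredholm.

Section Scale.
Variables (R : realType) (h : growth R).

Definition incl_const (r s : R) : R := (h 0 `^ (r - s))^-1.

Lemma incl_const_gt0 r s : 0 < incl_const r s.
Proof. by rewrite invr_gt0 powR_gt0// growth_gt0. Qed.

Lemma wt_incl (s r : R) n : s <= r -> wt h s n <= incl_const r s * wt h r n.
Proof.
move=> sr; have -> : wt h r n = h n `^ (r - s) * h n `^ s.
  by rewrite -powRD ?subrK// (gt_eqF (growth_gt0 _ _)) implybT.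
rewrite /wt /incl_const mulrA ler_peMl ?powR_ge0// mulrC ler_pdivlMr ?powR_gt0 ?growth_gt0//.
rewrite mul1r; apply: ge0_ler_powR; rewrite ?subr_ge0// ?nnegrE.
- exact/ltW/growth_gt0.
- exact/ltW/growth_gt0.
- exact: growth_homo.
Qed.

Lemma incl_subproof (s r : R) (sr : s <= r) (x : wl2 h r) :
  wl2_pred h s (wl2_seq x).
Proof.
have /asboolP cx := wl2_seqP x; apply/asboolP.
have cz : cvgn (series (fun n => incl_const r s * (wt h r n * x n ^+ 2))).
  exact: (is_cvg_seriesZ (k := incl_const r s)).
apply: wl2_dom cz => n; have E (a : R) :
    `|wt h s n * a ^+ 2| <= incl_const r s * (wt h r n * a ^+ 2).
  rewrite ger0_norm; last exact: mulr_ge0 (ltW (wt_gt0 _ _ _)) (sqr_ge0 _).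
  rewrite mulrA.
  by rewrite ler_wpM2r ?sqr_ge0// wt_incl.
exact: E.
Qed.

Definition incl_fun (s r : R) (sr : s <= r) (x : wl2 h r) : wl2 h s :=
  Wl2 (incl_subproof sr x).

Lemma incl_bounded (s r : R) (sr : s <= r) : bop_pred (incl_fun sr).
Proof.
apply/asboolP; split; first by move=> a x y; exact: val_inj.
exists (Num.sqrt (incl_const r s)) => x.
change (wl2_norm (incl_fun sr x) <= Num.sqrt (incl_const r s) * wl2_norm x).
rewrite /wl2_norm -sqrtrM ?(ltW (incl_const_gt0 _ _))// ler_wsqrtr//.
rewrite /wl2_dot -[_ * _](lim_seriesZ (incl_const r s)); last exact: wl2_dot_cvg.
apply: lim_series_le; first exact: wl2_dot_cvg.
  by apply: is_cvg_seriesZ; exact: wl2_dot_cvg.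
move=> n; have E (a : R) :
    wt h s n * (a * a) <= incl_const r s * (wt h r n * (a * a)).
  by rewrite -expr2 mulrA ler_wpM2r ?sqr_ge0// wt_incl.
exact: E.
Qed.

Definition incl (s r : R) (sr : s <= r) : bop (wl2 h r) (wl2 h s) :=
  Bop (incl_bounded sr).

Lemma le12 : 1 <= 2 :> R.
Proof. by rewrite ler1n. Qed.

End Scale.

Section Hessians.
Variables (R : realType) (h : growth R).

Local Notation H0 := (wl2 h 0).
Local Notation H1 := (wl2 h 1).
Local Notation H2 := (wl2 h 2).
Local Notation L10xL21 := (bop H1 H0 * bop H2 H1)%type.

Definition iota10 : bop H1 H0 := incl h ler01.
Definition iota21 : bop H2 H1 := incl h (le12 R).

(* An element of L(H_1, H_0) \cap L(H_2, H_1) is encoded as the pair (A, B) of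
   A : H_1 -> H_0 and its restriction B : H_2 -> H_1; the library norm of the
   product is the maximum of the two operator norms. *)
Definition weak_hessian : set L10xL21 :=
  [set A : L10xL21 | [/\ forall x : H2, iota10 (A.2 x) = A.1 (iota21 x),
     forall x y : H1, wl2_dot (A.1 x) (iota10 y) = wl2_dot (iota10 x) (A.1 y),
     fredholm_index A.1 0 & fredholm_index A.2 0]].

Definition spec (T : bop H1 H0) : set R :=
  [set l | ~ isomorphism (T - l *: iota10)].

Definition eigenspace (T : bop H1 H0) (l : R) : set H1 :=
  [set x | T x = l *: iota10 x].

Definition eigenvalue (T : bop H1 H0) : set R :=
  [set l | exists2 x, x != 0 & eigenspace T l x].

Definition floer : set L10xL21 :=
  [set A : L10xL21 | [/\ weak_hessian A,
     infinite_set [set l | 0 < l /\ eigenvalue A.1 l] &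
     infinite_set [set l | l < 0 /\ eigenvalue A.1 l]]].

(* The graph of T |-> f_T^+: a nondecreasing positive f lists the positive
   eigenvalues with multiplicities iff it takes each mu > 0 exactly as many
   times as the dimension of the eigenspace of mu; this determines f. *)
Definition pos_growth (T : bop H1 H0) (f : growth R) : Prop :=
  forall mu, 0 < mu ->
    exists2 k, ([set n | f n = mu] #= `I_k)%card &
      has_dim (eigenspace T mu) k.

(* The graph of T |-> f_T^-, listing absolute values of negative eigenvalues. *)
Definition neg_growth (T : bop H1 H0) (f : growth R) : Prop :=
  forall mu, 0 < mu ->
    exists2 k, ([set n | f n = mu] #= `I_k)%card &
      has_dim (eigenspace T (- mu)) k.

Definition floer_ab (a b : set (growth R)) : set L10xL21 :=
  [set A : L10xL21 | floer A /\ forall l, ~ spec A.1 l ->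
    (exists2 f, neg_growth (A.1 - l *: iota10) f & growth_class f = a) /\
    (exists2 f, pos_growth (A.1 - l *: iota10) f & growth_class f = b)].

End Hessians.

Arguments weak_hessian {R} h.
Arguments floer {R} h.
Arguments floer_ab {R} h a b.

(* Main.v *)
From HB Require Import structures.
Require Import Defs.
From mathcomp Require Import all_boot all_order all_algebra.
From mathcomp Require Import all_classical all_reals all_analysis.
From mathcomp Require Import ring lra zify.

Set Implicit Arguments.
Unset Strict Implicit.
Unset Printing Implicit Defensive.

Import Order.TTheory GRing.Theory Num.Theory.
Import numFieldNormedType.Exports.

Local Open Scope classical_set_scope.
Local Open Scope ring_scope.

(* If [T : H1 -> H0] is symmetric and invertible with inverse [S], then [iota S]
   is compact and symmetric on [H0], and maximizing its form successively on the
   orthogonal complements of the eigenvectors already found lists the positive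
   eigenvalues [f 0 <= f 1 <= ...] of [T] together with the min-max principle:
   [f n <= k] as soon as [|T y|^2 <= k <T y, y>] on some subspace of dimension
   [n + 1]. Testing with the span of the first eigenvectors of [T], an inequality
   [|E x| <= |T x| / 2] for a symmetric [E] makes the [n]-th positive eigenvalue
   of [T + E] at most [9/2] times that of [T], since by Heinz's inequality [E] is
   also small as a form relative to [T] on that span. Replacing [T] by
   [T + d iota] changes the list by a finite shift and a bounded factor, which a
   shift-invariant growth type does not see. As every symmetric Fredholm [A] of
   index zero has a real [l] with [A - l iota] invertible, membership of [A] in
   [F^ab] is decided at this single [l], where it is stable under small
   perturbations, both of [A] in [F^ab] and of [A] outside it. Negative
   eigenvalues are handled through [- A]. *)

(** * The weighted sequence spaces as Hilbert spaces *)

Section InnerProduct.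
Variables (R : realType) (h : growth R) (r : R).
Implicit Types x y z : wl2 h r.
Local Notation dot := (@wl2_dot R h r).

Lemma dotDl x y z : dot (x + y) z = dot x z + dot y z.
Proof. by rewrite -[x in x + y]scale1r wl2_dotDZl mul1r. Qed.

Lemma dot0l z : dot 0 z = 0.
Proof. by have := dotDl 0 0 z; rewrite addr0; lra. Qed.

Lemma dotZl a x z : dot (a *: x) z = a * dot x z.
Proof. by rewrite -[a *: x]addr0 wl2_dotDZl dot0l addr0. Qed.

Lemma dotNl x z : dot (- x) z = - dot x z.
Proof. by rewrite -scaleN1r dotZl mulN1r. Qed.

Lemma dotBl x y z : dot (x - y) z = dot x z - dot y z.
Proof. by rewrite dotDl dotNl. Qed.

Lemma dotDr x y z : dot z (x + y) = dot z x + dot z y.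
Proof. by rewrite ![dot z _]wl2_dotC dotDl. Qed.

Lemma dot0r z : dot z 0 = 0.
Proof. by rewrite wl2_dotC dot0l. Qed.

Lemma dotZr a x z : dot z (a *: x) = a * dot z x.
Proof. by rewrite ![dot z _]wl2_dotC dotZl. Qed.

Lemma dotNr x z : dot z (- x) = - dot z x.
Proof. by rewrite ![dot z _]wl2_dotC dotNl. Qed.

Lemma dotBr x y z : dot z (x - y) = dot z x - dot z y.
Proof. by rewrite dotDr dotNr. Qed.

Lemma dot_suml I (s : seq I) (P : pred I) (F : I -> wl2 h r) z :
  dot (\sum_(i <- s | P i) F i) z = \sum_(i <- s | P i) dot (F i) z.
Proof. by apply: (big_morph (dot^~ z)) => [x y|]; rewrite ?dotDl ?dot0l. Qed.

Lemma dot_sumr I (s : seq I) (P : pred I) (F : I -> wl2 h r) z :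
  dot z (\sum_(i <- s | P i) F i) = \sum_(i <- s | P i) dot z (F i).
Proof. by rewrite wl2_dotC dot_suml; under eq_bigr do rewrite wl2_dotC. Qed.

Lemma dot_norm x : dot x x = `|x| ^+ 2.
Proof. by rewrite sqr_sqrtr// wl2_dot_ge0. Qed.

Lemma dot_eq0 x : dot x x = 0 -> x = 0.
Proof.
by move=> x0; apply/eqP; rewrite -normr_eq0 -sqrf_eq0 -dot_norm x0.
Qed.

Lemma dot_gt0 x : x != 0 -> 0 < dot x x.
Proof. by move=> x0; rewrite dot_norm exprn_gt0// normr_gt0. Qed.

Lemma dot_normalize x : x != 0 -> dot (`|x|^-1 *: x) (`|x|^-1 *: x) = 1.
Proof.
move=> x0; rewrite dotZl dotZr dot_norm mulrA -expr2 exprVn.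
by apply: mulVf; rewrite expf_eq0 normr_eq0 (negbTE x0).
Qed.

Lemma dot_le_norm x y : `|dot x y| <= `|x| * `|y|.
Proof.
rewrite -(@ler_pXn2r _ 2)// ?nnegrE ?mulr_ge0//.
by rewrite exprMn -!dot_norm real_normK ?num_real// wl2_CS.
Qed.

Lemma wl2P x y : (forall n, x n = y n) -> x = y.
Proof. by move=> xy; apply/val_inj/funext. Qed.

Lemma wl2Z a x n : (a *: x) n = a * x n. Proof. by []. Qed.

Lemma wl2_sum I (s : seq I) (P : pred I) (F : I -> wl2 h r) n :
  (\sum_(i <- s | P i) F i) n = \sum_(i <- s | P i) F i n.
Proof. by apply: (big_morph (fun x : wl2 h r => x n)). Qed.

Lemma wl2_partial_le x N :
  \sum_(0 <= n < N) wt h r n * x n ^+ 2 <= `|x| ^+ 2.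
Proof.
rewrite -dot_norm /wl2_dot.
have -> : (fun n => wt h r n * (x n * x n)) = (fun n => wt h r n * x n ^+ 2).
  by apply/funext => n; rewrite expr2.
apply: (@nondecreasing_cvgn_le _ (series _)); last first.
  exact/asboolP/wl2_seqP.
apply/nondecreasing_seqP => n; rewrite /series/= big_nat_recr//= lerDl.
by rewrite mulr_ge0 ?sqr_ge0 ?(ltW (wt_gt0 _ _ _)).
Qed.

Lemma wl2_coord_le x n : wt h r n * x n ^+ 2 <= `|x| ^+ 2.
Proof. by rewrite -dot_norm; exact: wl2_dot_coord. Qed.

Lemma wl2_partial_pred (x : nat -> R) (M : R) :
  (forall N, \sum_(0 <= n < N) wt h r n * x n ^+ 2 <= M) ->
  wl2_pred h r (x : nat -> R^o).
Proof.
move=> xM; apply/asboolP; apply: nondecreasing_is_cvgn.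
  apply/nondecreasing_seqP => n; rewrite /series/= big_nat_recr//= lerDl.
  by rewrite mulr_ge0 ?sqr_ge0 ?(ltW (wt_gt0 _ _ _)).
by exists M => _ [N _ <-]; exact: xM.
Qed.

Lemma wl2_norm_le x (M : R) : 0 <= M ->
  (forall N, \sum_(0 <= n < N) wt h r n * x n ^+ 2 <= M ^+ 2) -> `|x| <= M.
Proof.
move=> M0 xM; rewrite -(@ler_pXn2r _ 2)// ?nnegrE//.
rewrite -dot_norm; apply: limr_le; first exact: wl2_dot_cvg.
apply: nearW => N; apply: le_trans (xM N); rewrite /series /=.
by apply: ler_sum => n _; rewrite expr2.
Qed.

End InnerProduct.

(** * Completeness of the weighted sequence spaces *)

Section Completeness.
Variables (R : realType) (h : growth R) (r : R).

(** Each coordinate is a Cauchy filter on the reals, which yields a coordinatewise limit [L]; bounds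
    on finite partial sums pass to the limit and give both the summability of [L] and convergence in
    norm. Completeness of [H0] serves the Banach fixed point theorem and the Banach-Steinhaus
    theorem below. *)
Lemma wl2_complete (F : set_system (wl2 h r)) :
  ProperFilter F -> cauchy F -> cvg F.
Proof.
move=> FF /cauchyP FC.
have coord n : cauchy ((fun x : wl2 h r => x n : R^o) @ F).
  apply: cauchy_exP => _/posnumP[e].
  pose w := Num.sqrt (wt h r n).
  have w0 : 0 < w by rewrite sqrtr_gt0 wt_gt0.
  have [|x0 Fx0] := FC (w * e%:num); first by rewrite mulr_gt0.
  exists (x0 n).
  change (F [set x : wl2 h r | ball (x0 n : R^o) e%:num (x n)]).
  apply: filterS Fx0 => x.
  rewrite -!ball_normE /ball_ /= => xx0.
  rewrite -(ltr_pM2l w0); apply: le_lt_trans xx0.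
  rewrite -(@ler_pXn2r _ 2)// ?nnegrE ?mulr_ge0 ?(ltW w0)//.
  rewrite exprMn sqr_sqrtr ?(ltW (wt_gt0 _ _ _))// real_normK ?num_real//.
  exact: (wl2_coord_le (x0 - x)).
pose L n : R := lim ((fun x : wl2 h r => x n : R^o) @ F).
have Lc n : (fun x : wl2 h r => x n : R^o) @ F --> L n.
  exact: (cauchy_cvg _ (coord n)).
(* A partial sum involves finitely many coordinates only, so the bound valid on the ball survives in
   the limit along [F]. *)
have key (e : R) (x0 : wl2 h r) N : F (ball x0 e) ->
    \sum_(0 <= n < N) wt h r n * (L n - x0 n) ^+ 2 <= e ^+ 2.
  move=> Fx0.
  have Fc : (fun x : wl2 h r =>
      \sum_(0 <= n < N) wt h r n * (x n - x0 n) ^+ 2 : R^o) @ F -->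
      \sum_(0 <= n < N) wt h r n * (L n - x0 n) ^+ 2.
    elim: N => [|N IH].
      rewrite big_geq//; under eq_fun do rewrite big_geq//.
      exact: cvg_cst.
    rewrite big_nat_recr//=; under eq_fun do rewrite big_nat_recr//= expr2.
    apply: cvgD IH _; rewrite expr2.
    by apply: cvgM; [exact: cvg_cst|apply: cvgM; apply: cvgB;
      by [exact: Lc|exact: cvg_cst]].
  apply: (cvgr_to_le Fc).
  apply: filterS Fx0 => x; rewrite -ball_normE /ball_ /= => x0x.
  rewrite (le_trans (wl2_partial_le (x - x0) N))//.
  have e0 : 0 <= e := le_trans (normr_ge0 _) (ltW x0x).
  by rewrite ler_pXn2r ?nnegrE// distrC ltW.
have [x1 Fx1] := FC 1 ltr01.
have Lp : wl2_pred h r L.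
  (* [L] is the sum of [L - x1], square summable by [key] with radius 1, and of [x1]. *)
  have -> : (L : nat -> R^o) = (fun n => L n - x1 n) + wl2_seq x1.
    by apply/funext => n; rewrite /GRing.add /= subrK.
  have Lp1 : wl2_pred h r (fun n => L n - x1 n).
    by apply: wl2_partial_pred => N; exact: key Fx1.
  exact: (wl2_seqP (Wl2 Lp1 + x1)).
apply/cvg_ex; exists (Wl2 Lp); apply/cvgrPdist_le => _/posnumP[e].
have e2 : 0 < e%:num / 2 by [].
have [x0 Fx0] := FC _ e2.
have Lx0 : `|Wl2 Lp - x0| <= e%:num / 2.
  by apply: wl2_norm_le => // N; exact: key.
apply: filterS Fx0 => x; rewrite -ball_normE /ball_ /= => x0x.
rewrite -(subrKA x0) (le_trans (ler_normD _ _))//.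
by rewrite (splitr e%:num) lerD// ltW.
Qed.

HB.instance Definition _ := Uniform_isComplete.Build (wl2 h r) wl2_complete.

End Completeness.

(** * Bounded operators and the compact inclusion *)

Section Operators.
Variables (R : realType) (V W : normedModType R).
Implicit Types S T : bop V W.

Lemma bopD S T x : (S + T) x = S x + T x. Proof. by []. Qed.
Lemma bopN T x : (- T) x = - T x. Proof. by []. Qed.
Lemma bopB S T x : (S - T) x = S x - T x. Proof. by []. Qed.
Lemma bopZ a T x : (a *: T) x = a *: T x. Proof. by []. Qed.

Lemma bop_sum I (s : seq I) (P : pred I) (F : I -> bop V W) x :
  (\sum_(i <- s | P i) F i) x = \sum_(i <- s | P i) F i x.
Proof. by apply: (big_morph (fun T : bop V W => T x)). Qed.

Lemma bopDr T x y : T (x + y) = T x + T y. Proof. exact: linearD. Qed.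
Lemma bopNr T x : T (- x) = - T x. Proof. exact: linearN. Qed.
Lemma bopBr T x y : T (x - y) = T x - T y. Proof. exact: linearB. Qed.
Lemma bopZr T a x : T (a *: x) = a *: T x. Proof. exact: linearZ. Qed.
Lemma bop0r T : T 0 = 0. Proof. exact: linear0. Qed.

Lemma bop_sumr T I (s : seq I) (P : pred I) (F : I -> V) :
  T (\sum_(i <- s | P i) F i) = \sum_(i <- s | P i) T (F i).
Proof. exact: linear_sum. Qed.

Definition mkbop (f : V -> W) (lf : linear f)
    (bf : exists M : R, forall x, `|f x| <= M * `|x|) : bop V W :=
  Bop (asboolT (conj lf bf)).

End Operators.

(** * Compactness of the inclusion of [H1] into [H0] *)

Section Scale01.
Variables (R : realType) (h : growth R).

Local Notation H0 := (wl2 h 0).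
Local Notation H1 := (wl2 h 1).
Local Notation iota := (iota10 h).
Local Notation dot := (@wl2_dot R h 0).

Lemma wt0 n : wt h 0 n = 1. Proof. exact: powRr0. Qed.
Lemma wt1 n : wt h 1 n = h n. Proof. exact/powRr1/ltW/growth_gt0. Qed.

Lemma iotaE (x : H1) n : iota x n = x n. Proof. by []. Qed.

Lemma iota_inj : injective iota.
Proof. by move=> x y xy; apply: wl2P => n; rewrite -!iotaE xy. Qed.

Lemma iota_eq0 (x : H1) : (iota x == 0) = (x == 0).
Proof.
by apply/eqP/eqP => [x0|->]; [apply: iota_inj; rewrite linear0|rewrite linear0].
Qed.

(** Beyond index [N] one has [h N * x n ^+ 2 <= h n * x n ^+ 2] by monotonicity of [h]. Since [h] is
    unbounded, tails are uniformly small on bounded sets of [H1]; this is the source of all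
    compactness below. *)
Lemma iota_tail (x : H1) N :
  `|iota x| ^+ 2 <= \sum_(0 <= n < N) x n ^+ 2 + `|x| ^+ 2 / h N.
Proof.
have hN := growth_gt0 h N.
rewrite -(dot_norm (iota x)); apply: limr_le; first exact: wl2_dot_cvg.
exists N => // m /= Nm; rewrite /series/= (big_cat_nat (n := N))//=; apply: lerD.
  by apply: ler_sum => n _; rewrite wt0 mul1r expr2.
rewrite ler_pdivlMr//; apply: le_trans (wl2_partial_le x m).
rewrite [leRHS](big_cat_nat (n := N))//= ler_wpDl//.
  by apply: sumr_ge0 => n _; rewrite mulr_ge0 ?sqr_ge0 ?(ltW (wt_gt0 _ _ _)).
rewrite mulr_suml; apply: ler_sum_nat => n /andP[Nn _].
rewrite wt0 mul1r wt1 -expr2 mulrC.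
by rewrite ler_wpM2r ?sqr_ge0// growth_homo.
Qed.

Lemma dot_orthonormal (I : finType) (u : I -> H0) (a b : I -> R) :
  (forall i j, dot (u i) (u j) = (i == j)%:R) ->
  dot (\sum_i a i *: u i) (\sum_i b i *: u i) = \sum_i a i * b i.
Proof.
move=> ou; rewrite dot_suml; apply: eq_bigr => i _.
rewrite dotZl dot_sumr (bigD1 i)//= dotZr ou eqxx mulr1 big1 ?addr0// => j ji.
by rewrite dotZr ou eq_sym (negbTE ji) mulr0.
Qed.

Lemma dot_orthonormal_coef (I : finType) (u : I -> H0) (a : I -> R) i :
  (forall i j, dot (u i) (u j) = (i == j)%:R) ->
  dot (\sum_i a i *: u i) (u i) = a i.
Proof.
move=> ou; rewrite dot_suml (bigD1 i)//= dotZl ou eqxx mulr1 big1 ?addr0//.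
by move=> j ji; rewrite dotZl ou (negbTE ji) mulr0.
Qed.

(** Choose [N] with [h N > 2 M^2]: by the tail estimate every [u i] has at least half of its squared
    [H0]-norm in the first [N] coordinates. By Bessel each coordinate carries total mass at most 1,
    hence [n / 2 <= N]. *)
Lemma orthonormal_card (M : R) : exists B : nat, forall n (u : 'I_n -> H1),
  (forall i j, dot (iota (u i)) (iota (u j)) = (i == j)%:R) ->
  (forall i, `|u i| <= M) -> (n <= B)%N.
Proof.
have [N hN] := growth_unbounded h (2 * M ^+ 2).
exists N.*2 => n u ou uM.
have bessel m : \sum_i u i m ^+ 2 <= 1.
  set q := \sum_i _.
  (* The [m]-th coordinate of [w] and its squared norm both equal [q], so [q ^+ 2 <= q]. *)
  pose w := \sum_i u i m *: iota (u i).
  have wm : w m = q by rewrite /w wl2_sum; apply: eq_bigr => i _; rewrite expr2.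
  have wq : dot w w = q.
    by rewrite dot_orthonormal//; apply: eq_bigr => i _; rewrite expr2.
  have := wl2_coord_le w m; rewrite wt0 mul1r wm -dot_norm wq => qq.
  by have := sqr_ge0 (q - 1); nra.
have half i : 2^-1 <= \sum_(0 <= m < N) u i m ^+ 2.
  have := iota_tail (u i) N; rewrite -(dot_norm (iota (u i))) ou eqxx /= => le1.
  have : `|u i| ^+ 2 / h N <= 2^-1.
    rewrite ler_pdivrMr ?growth_gt0//.
    have : `|u i| ^+ 2 <= M ^+ 2.
      by rewrite ler_pXn2r ?nnegrE ?(le_trans _ (uM i)).
    lra.
  lra.
have : \sum_(i < n) (2^-1 : R) <= \sum_(0 <= m < N) (1 : R).
  apply: (@le_trans _ _ (\sum_(i < n) \sum_(0 <= m < N) u i m ^+ 2)).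
    by apply: ler_sum.
  by rewrite exchange_big; apply: ler_sum => m _; exact: bessel.
rewrite !sumr_const card_ord big_const_nat subn0 iter_addr addr0.
rewrite -[_ *+ n]mulr_natr -muln2 -(ler_nat R) natrM; lra.
Qed.

(** Compactness of [iota] in cluster point form: the coordinates of [y j] lie in fixed intervals,
    Tychonoff gives a coordinatewise cluster point, and the tail estimate turns closeness of
    finitely many coordinates into closeness in [H0]. *)
Lemma bounded_cluster (y : nat -> H1) (M : R) : (forall j, `|y j| <= M) ->
  exists p : H1, forall e, 0 < e -> forall J : nat,
    exists2 j, (J <= j)%N & `|iota (y j - p)| < e.
Proof.
move=> yM.
have M0 : 0 <= M := le_trans (normr_ge0 _) (yM 0).
pose C n := M / Num.sqrt (h n).
have sh n : 0 < Num.sqrt (h n) by rewrite sqrtr_gt0 growth_gt0.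
have yC j n : - C n <= y j n <= C n.
  rewrite -ler_norml ler_pdivlMr// -(@ler_pXn2r _ 2) ?nnegrE ?mulr_ge0 ?(ltW (sh n))//.
  rewrite exprMn sqr_sqrtr ?(ltW (growth_gt0 _ _))// real_normK ?num_real//.
  rewrite mulrC -wt1; apply: le_trans (wl2_coord_le (y j) n) _.
  by rewrite ler_pXn2r ?nnegrE.
have co : forall n, compact (`[- C n, C n] : set R^o).
  by move=> n; exact: segment_compact.
have [|p [_ clp]] := tychonoff co
    (F := (fun j => (wl2_seq (y j) : forall n : nat, R^o)) @ \oo).
  by exists 0%N => // j _ n; rewrite /= in_itv /= yC.
have clu e N J : 0 < e -> exists2 j, (J <= j)%N &
    forall n, (n < N)%N -> `|y j n - p n| < e.
  move=> e0.
  have np : nbhs p [set f : forall n : nat, R^o |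
      forall n, (n < N)%N -> `|f n - p n| < e].
    elim: N => [|N IH]; first by apply: filterE => f n.
    have pc := @proj_continuous _ (fun=> R^o) N p _ (nbhsx_ballx (p N : R^o) e e0).
    apply: filterS2 IH pc => f fN pf n.
    rewrite ltnS leq_eqVlt => /orP[/eqP->|/fN//].
    by rewrite distrC; exact: pf.
  have FJ : ((fun j => (wl2_seq (y j) : forall n : nat, R^o)) @ \oo)
      [set wl2_seq (y j) | j in [set j | J <= j]%N].
    by exists J => // j /= Jj; exists j.
  have [_ [[j Jj <-] jN]] := clp _ _ FJ np.
  by exists j.
have pp : wl2_pred h 1 (p : nat -> R^o).
  (* From [p n ^+ 2 <= 2 y n ^+ 2 + 2 (y n - p n) ^+ 2]: the first terms sum to at most [2 M^2], and
     choosing [y j] within [1 / (K + 1)] of [p] makes the second sum at most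
     [2 K / (K + 1)^2 <= 2]. *)
  apply: (@wl2_partial_pred _ _ _ _ (2 * M ^+ 2 + 2)) => N.
  set K := \sum_(0 <= n < N) h n.
  have K0 : 0 <= K by apply: sumr_ge0 => n _; exact/ltW/growth_gt0.
  have e0 : 0 < (K + 1)^-1 by rewrite invr_gt0; lra.
  have [j _ jN] := clu _ N 0%N e0.
  apply: (@le_trans _ _ (\sum_(0 <= n < N) (2 * (wt h 1 n * y j n ^+ 2)
      + 2 * (h n * (K + 1)^-1 ^+ 2)))).
    apply: ler_sum_nat => n /= nN; rewrite wt1.
    have := jN _ nN; have := growth_gt0 h n.
    move: (h n) (y j n : R) (p n : R) (K + 1)^-1 e0 => a b c e e0 a0 bc.
    have : (b - c) ^+ 2 <= e ^+ 2.
      by rewrite -[(b - c) ^+ 2]real_normK ?num_real// ler_pXn2r ?nnegrE// ltW.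
    have := sqr_ge0 (2 * b - c) => s1 s2.
    have -> : 2 * (a * b ^+ 2) + 2 * (a * e ^+ 2)
      = a * (2 * b ^+ 2 + 2 * e ^+ 2) by ring.
    by rewrite ler_pM2l//; lra.
  rewrite big_split /= -!mulr_sumr -mulr_suml -/K lerD//.
    rewrite ler_pM2l// (le_trans (wl2_partial_le _ _))//.
    by rewrite ler_pXn2r ?nnegrE.
  have -> : K * (K + 1)^-1 ^+ 2 = (K / (K + 1)) * (K + 1)^-1 by ring.
  have K1 : K / (K + 1) <= 1 by rewrite ler_pdivrMr ?mul1r; lra.
  have K2 : (K + 1)^-1 <= 1 by rewrite invf_le1; lra.
  have K3 : 0 <= K / (K + 1) by rewrite divr_ge0//; lra.
  by rewrite -[leRHS]mulr1 ler_pM2l// -[leRHS]mulr1 ler_pM// ltW.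
exists (Wl2 pp) => e e0 J.
set q := Wl2 pp.
set D := M + `|q|.
(* With this [N] the tail of [y j - q] contributes less than [e^2 / 2]; the radius [e'] below keeps
   the first [N] coordinates under [e^2 / 4]. *)
have [N hN] := growth_unbounded h (2 * D ^+ 2 / e ^+ 2).
have e'0 : 0 < e / (2 * N.+1%:R) by rewrite divr_gt0.
have [j Jj jN] := clu _ N J e'0.
exists j => //.
rewrite -(@ltr_pXn2r _ 2) ?nnegrE ?(ltW e0)//.
apply: le_lt_trans (iota_tail _ N) _.
have N1 : 1 <= N.+1%:R :> R by rewrite ler1n.
have t1 : \sum_(0 <= n < N) (y j - q) n ^+ 2 <= e ^+ 2 / 4.
  apply: (@le_trans _ _ (\sum_(0 <= n < N) (e / (2 * N.+1%:R)) ^+ 2)).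
    apply: ler_sum_nat => n /= nN.
    rewrite -[X in X <= _](@real_normK _ ((y j - q) n)) ?num_real//.
    by rewrite ler_pXn2r ?nnegrE ?(ltW e'0)// ltW// jN.
  rewrite big_const_nat subn0 iter_addr addr0 -[_ *+ N]mulr_natr.
  rewrite exprMn -mulrA ler_wpM2l ?sqr_ge0//.
  rewrite exprVn exprMn invfM -natrX -mulrA [leRHS](_ : _ = (2 ^ 2)%:R^-1 * 1).
    rewrite ler_pM2l// ler_pdivrMl ?exprn_gt0 ?ltr0n// mulr1.
    by rewrite -natrX ler_nat (leq_trans (leqnSn _))// leq_pmulr.
  by rewrite mulr1.
have t2 : `|y j - q| ^+ 2 / h N < e ^+ 2 / 2.
  rewrite ltr_pdivrMr ?growth_gt0//.
  have : `|y j - q| ^+ 2 <= D ^+ 2.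
    rewrite ler_pXn2r ?nnegrE ?addr_ge0// (le_trans (ler_normB _ _))//.
    by rewrite lerD2r.
  move: hN; rewrite ltr_pdivrMr ?exprn_gt0//; lra.
have := sqr_ge0 e; lra.
Qed.

End Scale01.

(** * Extremal eigenvectors *)

Lemma eq0_of_small (R : realFieldType) (x M : R) : 0 <= M ->
  (forall e, 0 < e -> `|x| <= M * e) -> x = 0.
Proof.
move=> M0 xM; apply/eqP; rewrite -normr_le0 leNgt; apply/negP => x0.
have M1 : 0 < M + 1 by lra.
have := xM (`|x| / (M + 1)) (divr_gt0 x0 M1).
by rewrite mulrA ler_pdivlMr// mulrC ler_pM2r//; lra.
Qed.

Section Spectral.
Variables (R : realType) (h : growth R).

Local Notation H0 := (wl2 h 0).
Local Notation H1 := (wl2 h 1).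
Local Notation iota := (iota10 h).
Local Notation dot := (@wl2_dot R h 0).

Definition rank1_fun (a : H0) (b : H1) (z : H0) : H1 := dot z a *: b.

Lemma rank1_linear a b : linear (rank1_fun a b).
Proof. by move=> k x y; rewrite /rank1_fun dotDl dotZl scalerDl scalerA. Qed.

Lemma rank1_bounded a b :
  exists M : R, forall z, `|rank1_fun a b z| <= M * `|z|.
Proof.
exists (`|a| * `|b|) => z; rewrite normrZ mulrC -mulrA [leRHS]mulrCA.
by rewrite ler_wpM2l// mulrC dot_le_norm.
Qed.

Definition rank1 (a : H0) (b : H1) : bop H0 H1 :=
  mkbop (@rank1_linear a b) (rank1_bounded a b).

Lemma rank1E a b z : rank1 a b z = dot z a *: b. Proof. by []. Qed.

Definition perp (l : seq H1) (z : H0) : Prop :=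
  forall a, a \in l -> dot z (iota a) = 0.

Lemma perpD l x y : perp l x -> perp l y -> perp l (x + y).
Proof. by move=> px py a al; rewrite dotDl px// py// addr0. Qed.

Lemma perpZ l k x : perp l x -> perp l (k *: x).
Proof. by move=> px a al; rewrite dotZl px// mulr0. Qed.

Lemma perpB l x y : perp l x -> perp l y -> perp l (x - y).
Proof. by move=> px py; rewrite -scaleN1r; apply: perpD => //; exact: perpZ. Qed.

(** Let [s] be the supremum of the form [q] on the unit ball of the complement of [l]. Along a
    maximizing sequence [z j] the defect [b (z j) = s z - iota (K z)] tends to 0, and [K (z j)] is
    bounded in [H1], so it has a cluster point [p] for the [H0]-distance. Then [s z] also clusters
    at [iota p], which makes [p] an eigenvector for [s]. *)
Lemma extremal_eigenvector (K : bop H0 H1) (l : seq H1) :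
  (forall z w, dot (iota (K z)) w = dot z (iota (K w))) ->
  (forall a, a \in l -> exists k, K (iota a) = k *: a) ->
  (exists2 z, perp l z & 0 < dot (iota (K z)) z) ->
  exists u s, [/\ 0 < s, dot (iota u) (iota u) = 1, perp l (iota u),
    K (iota u) = s *: u &
    forall z, perp l z -> dot (iota (K z)) z <= s * dot z z].
Proof.
move=> symK eigl [z0 pz0 qz0].
pose q z := dot (iota (K z)) z.
pose C := opnorm iota * opnorm K.
have C0 : 0 <= C by rewrite mulr_ge0 ?opnorm_ge0.
have KC z : `|iota (K z)| <= C * `|z|.
  rewrite (le_trans (opnorm_ub _ _))// -mulrA ler_wpM2l ?opnorm_ge0//.
  exact: opnorm_ub.
have qC z : `|q z| <= C * dot z z.
  rewrite (le_trans (dot_le_norm _ _))// dot_norm expr2 mulrA ler_wpM2r//.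
pose Q := [set q z | z in [set z | perp l z /\ dot z z <= 1]].
have supQ : has_sup Q.
  split; first by exists (q 0), 0; split=> [a _|]; rewrite dot0l// ler01.
  exists C => _ [z [_ z1] <-]; rewrite (le_trans (ler_norm _))// (le_trans (qC z))//.
  by rewrite ler_piMr.
pose s := sup Q.
have qZ k z : q (k *: z) = k ^+ 2 * q z.
  by rewrite /q !bopZr dotZl dotZr mulrA -expr2.
have qs z : perp l z -> q z <= s * dot z z.
  move=> pz; have [->|z00] := eqVneq z 0; first by rewrite /q dot0r dot0r mulr0.
  have zz := dot_gt0 z00.
  have nz : 0 < `|z| by rewrite normr_gt0.
  rewrite -ler_pdivrMr//; apply: ub_le_sup; first by case: supQ.
  exists (`|z|^-1 *: z); last by rewrite qZ exprVn -dot_norm mulrC.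
  split; first exact: perpZ.
  by rewrite dotZl dotZr mulrA -expr2 exprVn -dot_norm mulVf ?gt_eqF.
have z00 : z0 != 0 by apply: contraTneq qz0 => ->; rewrite dot0r ltxx.
have s0 : 0 < s.
  rewrite -(pmulr_lgt0 _ (dot_gt0 z00)); exact: lt_le_trans qz0 (qs _ pz0).
have [b bE] : exists b : H0 -> H0, forall z, b z = s *: z - iota (K z).
  by exists (fun z => s *: z - iota (K z)).
(* The complement of [l] is invariant because [l] consists of eigenvectors of the symmetric [K]. *)
have pK z : perp l z -> perp l (iota (K z)).
  move=> pz a al; have [k ka] := eigl a al.
  by rewrite symK ka bopZr dotZr pz// mulr0.
have pb z : perp l z -> perp l (b z).
  by move=> pz; rewrite bE; apply: perpB; [exact: perpZ|exact: pK].
have sC : 0 < s + C by lra.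
(* Positivity of [s |z|^2 - <K z, z>] at [z - t b z] with [t = 1 / (s + C)]. *)
have bb z : perp l z -> dot (b z) (b z) <= (s + C) * (s * dot z z - q z).
  move=> pz; set t := (s + C)^-1.
  have t0 : 0 < t by rewrite invr_gt0.
  have := qs _ (perpB pz (perpZ t (pb z pz))).
  rewrite {1}/q !bopBr !bopZr !(dotBl, dotBr, dotZl, dotZr).
  rewrite -/(q z) -/(q (b z)) [dot (iota (K (b z))) z]symK.
  rewrite [dot (b z) z]wl2_dotC [dot (b z) (iota _)]wl2_dotC.
  have -> : dot (iota (K z)) (b z) = s * dot z (b z) - dot (b z) (b z).
    by rewrite [X in _ - dot X _]bE dotBl dotZl; ring.
  have := qC (b z); rewrite ler_norml => /andP[qb _].
  set B := dot (b z) (b z) in qb *; set Z := dot z (b z).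
  move=> le1; rewrite -ler_pdivrMl// -/t.
  have tsC : t * (s + C) = 1 by rewrite mulVf ?gt_eqF.
  have : t * (t * (s * B - q (b z))) <= t * B.
    rewrite ler_pM2l//.
    have : t * (s * B - q (b z)) <= t * ((s + C) * B).
      rewrite ler_pM2l//; lra.
    by rewrite mulrA tsC mul1r.
  lra.
have seq j : exists z, [/\ perp l z, dot z z <= 1 & s - j.+1%:R^-1 < q z].
  have j0 : 0 < j.+1%:R^-1 :> R by rewrite invr_gt0.
  have [_ [z [pz z1] <-] sz] := sup_adherent j0 supQ.
  by exists z.
have [z zP] := choice seq.
have Kz j : `|K (z j)| <= opnorm K.
  have [_ z1 _] := zP j; rewrite (le_trans (opnorm_ub _ _))//.
  rewrite ler_piMr ?opnorm_ge0// -(@ler_pXn2r _ 2) ?nnegrE//.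
  by rewrite -dot_norm expr1n.
have [p clp] := bounded_cluster Kz.
(* A single nearly maximizing [w] with [s *: w] and [iota (K w)] both close to [iota p]; the
   properties of [p] follow by letting [e] tend to 0. *)
have approx e : 0 < e -> exists w, [/\ perp l w, dot w w <= 1, s - e < q w,
    `|s *: w - iota p| < e & `|iota (K w) - iota p| < e].
  move=> e0; have e20 : 0 < e / 2 by lra.
  (* The first bound gives [q w > s - e]; by [bb] the second gives [|b w| < e / 2]. *)
  pose d := Num.min e ((e / 2) ^+ 2 / (s + C)).
  have d0 : 0 < d by rewrite lt_min e0 divr_gt0// exprn_gt0.
  have [J Jd] : exists J : nat, J.+1%:R^-1 < d.
    by exists (Num.truncn d^-1); rewrite invf_plt ?posrE ?truncnS_gt.
  have [j Jj jp] := clp _ e20 J; exists (z j).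
  have [pz z1 sz] := zP j.
  have jd : j.+1%:R^-1 < d.
    by apply: le_lt_trans Jd; rewrite lef_pV2 ?posrE// ler_nat.
  have [de dC] : d <= e /\ d <= (e / 2) ^+ 2 / (s + C).
    by split; rewrite ge_min lexx ?orbT.
  have bj : `|b (z j)| < e / 2.
    rewrite -(@ltr_pXn2r _ 2) ?nnegrE ?(ltW e20)// -dot_norm.
    apply: le_lt_trans (bb _ pz) _; rewrite mulrC -ltr_pdivlMr//.
    apply: lt_le_trans dC; apply: le_lt_trans jd.
    have : s * dot (z j) (z j) <= s * 1 by rewrite ler_pM2l.
    move: sz; set r := (_^-1); set D := dot _ _; set qj := q _.
    by move: r D qj => r D qj; lra.
  rewrite bopBr in jp; split => //.
  - by apply: le_lt_trans sz; rewrite lerD2l lerN2 ltW// (lt_le_trans jd).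
  - have -> : s *: z j - iota p = b (z j) + (iota (K (z j)) - iota p).
      by rewrite bE addrA subrK.
    by rewrite (le_lt_trans (ler_normD _ _))// (splitr e) ltrD.
  - by apply: lt_trans jp _; rewrite ltr_pdivrMr// ltr_pMr// ltr1n.
have pp : perp l (iota p).
  move=> a al; apply: (@eq0_of_small _ _ `|iota a|) => // e /approx[w [pw _ _ wp _]].
  have -> : dot (iota p) (iota a) = - dot (s *: w - iota p) (iota a).
    by rewrite dotBl dotZl (pw a al); ring.
  by rewrite normrN (le_trans (dot_le_norm _ _))// mulrC ler_wpM2l// ltW.
have Kp : K (iota p) = s *: p.
  apply: iota_inj; apply/eqP; rewrite -subr_eq0 -normr_eq0; apply/eqP.
  apply: (@eq0_of_small _ _ (C + s)) => [|e e0]; first by rewrite addrC ltW.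
  rewrite normr_id; have [w [pw _ _ wp Kwp]] := approx e e0.
  have -> : iota (K (iota p)) - iota (s *: p)
      = s *: (iota (K w) - iota p) - iota (K (s *: w - iota p)).
    by rewrite !bopBr !bopZr scalerBr opprB [RHS]addrC subrKA.
  apply: le_trans (ler_normB _ _) _.
  have -> : (C + s) * e = s * e + C * e by ring.
  rewrite normrZ (gtr0_norm s0); apply: lerD.
    by rewrite (ler_pM2l s0); exact: ltW Kwp.
  by apply: (le_trans (KC _)); apply: (ler_wpM2l C0); exact: ltW wp.
have p0 : p != 0.
  (* If [p = 0], then [s |w| <= e], so [s - e < q w <= C |w|] yields [s^2 <= (s + C) e], whereas
     this [e] makes the right side [s^2 / 2]. *)
  apply/eqP => p0; have e0 : 0 < s ^+ 2 / (2 * (s + C)).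
    by rewrite divr_gt0 ?exprn_gt0// mulr_gt0.
  have [w [pw w1 + + _]] := approx _ e0.
  rewrite p0 bop0r subr0 normrZ (gtr0_norm s0) ltr_pdivlMr ?mulr_gt0// => sq sw.
  have w1' : `|w| <= 1.
    by rewrite -(@ler_pXn2r _ 2) ?nnegrE// -dot_norm expr1n.
  have qw : q w <= C * `|w|.
    rewrite (le_trans (ler_norm _))// (le_trans (qC _))// ler_wpM2l//.
    by rewrite dot_norm expr2 ler_piMl.
  move: sq; set e := s ^+ 2 / _ => sq.
  have eE : e * (s + C) = s ^+ 2 / 2 by rewrite /e; field; rewrite gt_eqF.
  have : s * `|w| <= e by rewrite ler_pdivlMr ?mulr_gt0// ltW.
  have : 0 <= `|w| by [].
  move: (q w) (`|w|) sq qw => qw v sq qw' v0 sv.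
  have : C * (s * v) <= C * e by rewrite ler_wpM2l.
  have : s * (s - e) <= s * (C * v) by rewrite ler_pM2l//; lra.
  have : 0 < s ^+ 2 by rewrite exprn_gt0.
  move: eE; nra.
have np : 0 < `|iota p| by rewrite normr_gt0 iota_eq0.
exists (`|iota p|^-1 *: p), s; split.
- exact: s0.
- by rewrite bopZr; apply: dot_normalize; rewrite iota_eq0.
- by rewrite bopZr; exact: perpZ.
- by rewrite (bopZr iota) (bopZr K) Kp !scalerA mulrC.
- exact: qs.
Qed.

End Spectral.

(** * Positive eigensystems and the min-max principle *)

Lemma left_kernel (F : fieldType) (m n : nat) (C : 'M[F]_(n, m)) :
  (m < n)%N -> exists2 c : 'rV[F]_n, c != 0 & c *m C = 0.
Proof.
move=> mn; have : kermx C != 0.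
  by rewrite kermx_eq0 -row_leq_rank -ltnNge (leq_ltn_trans _ mn)// rank_leq_col.
case/rowV0Pn => c /sub_kermxP cC c0; by exists c.
Qed.

(** If [n > m], the coordinates of the second family in the first have a nonzero left kernel vector,
    which would be a second coordinate vector of 0. *)
Lemma has_dim_leq (R : realType) (U : lmodType R) (A : set U) (m n : nat) :
  A 0 -> has_dim A m -> has_dim A n -> (n <= m)%N.
Proof.
move=> A0 [e Ae eP] [e' Ae' e'P]; rewrite leqNgt; apply/negP => mn.
have /choice[C CP] j : exists c : 'rV[R]_m, e' j = \sum_i c 0 i *: e i.
  by have [c [cP _]] := eP _ (Ae' j); exists c.
have [a a0 aC] := left_kernel (\matrix_(j, i) C j 0 i) mn.
have [b [_ b_uniq]] := e'P _ A0.
have bz : b = 0.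
  by apply: b_uniq; rewrite big1// => i _; rewrite mxE scale0r.
move/eqP: a0; apply; rewrite -bz; apply/esym/b_uniq.
under eq_bigr do rewrite CP scaler_sumr.
rewrite exchange_big big1//= => i _.
under eq_bigr do rewrite scalerA.
rewrite -scaler_suml; have /rowP/(_ i) := aC; rewrite !mxE => aCi.
rewrite (_ : \sum_j _ = 0) ?scale0r//; rewrite -[RHS]aCi.
by apply: eq_bigr => j _; rewrite mxE.
Qed.

Lemma has_dim_uniq (R : realType) (U : lmodType R) (A : set U) (m n : nat) :
  A 0 -> has_dim A m -> has_dim A n -> m = n.
Proof.
by move=> A0 Am An; apply/eqP; rewrite eqn_leq !(has_dim_leq A0).
Qed.

Section Systems.
Variables (R : realType) (h : growth R).

Local Notation H0 := (wl2 h 0).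
Local Notation H1 := (wl2 h 1).
Local Notation iota := (iota10 h).
Local Notation dot := (@wl2_dot R h 0).
Implicit Types (T S : bop H1 H0) (f g : growth R).
Local Opaque iota10.

Lemma bessel n (u : 'I_n -> H0) (z : H0) :
  (forall i j, dot (u i) (u j) = (i == j)%:R) ->
  \sum_i dot z (u i) ^+ 2 <= dot z z.
Proof.
move=> ou; set w := \sum_i dot z (u i) *: u i.
have := wl2_dot_ge0 (z - w); rewrite dotBl !dotBr.
have -> : dot w w = \sum_i dot z (u i) ^+ 2.
  by rewrite dot_orthonormal//; apply: eq_bigr => i _; rewrite expr2.
have -> : dot w z = dot z w by exact: wl2_dotC.
have -> : dot z w = \sum_i dot z (u i) ^+ 2.
  by rewrite dot_sumr; apply: eq_bigr => i _; rewrite dotZr expr2.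
by lra.
Qed.

Definition sym_op T : Prop :=
  forall x y, dot (T x) (iota y) = dot (iota x) (T y).

Section EigenFamily.
Variables (T : bop H1 H0) (n : nat) (v : 'I_n -> H1) (mu c : 'I_n -> R).
Hypothesis ov : forall i j, dot (iota (v i)) (iota (v j)) = (i == j)%:R.
Hypothesis Tv : forall i, T (v i) = mu i *: iota (v i).
Let y := \sum_i c i *: v i.

Lemma iota_comb : iota y = \sum_i c i *: iota (v i).
Proof. by rewrite bop_sumr; apply: eq_bigr => i _; rewrite (bopZr iota). Qed.

Lemma eigen_comb : T y = \sum_i (c i * mu i) *: iota (v i).
Proof.
by rewrite bop_sumr; apply: eq_bigr => i _; rewrite (bopZr T) Tv scalerA.
Qed.

Lemma dot_eigen_iota : dot (T y) (iota y) = \sum_i mu i * c i ^+ 2.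
Proof.
rewrite iota_comb eigen_comb dot_orthonormal//.
by apply: eq_bigr => i _; ring.
Qed.

Lemma dot_eigen_eigen : dot (T y) (T y) = \sum_i mu i ^+ 2 * c i ^+ 2.
Proof.
by rewrite eigen_comb dot_orthonormal//; apply: eq_bigr => i _; ring.
Qed.

Lemma orthonormal_comb_eq0 : y = 0 -> forall i, c i = 0.
Proof.
move=> y0 i; rewrite -(dot_orthonormal_coef c i ov) -iota_comb y0.
by rewrite bop0r dot0l.
Qed.

End EigenFamily.

(** With [S] the inverse of [T] and [z = T y], the last clause is the Rayleigh bound
    [<S z, z> <= |z|^2 / f n] on the complement of the first [n] eigenvectors, stated without
    mentioning [S]. *)
Definition pos_system T (u : nat -> H1) f : Prop :=
  [/\ forall i j, dot (iota (u i)) (iota (u j)) = (i == j)%:R,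
      forall i, T (u i) = f i *: iota (u i) &
      forall n y, (forall i, (i < n)%N -> dot (iota y) (iota (u i)) = 0) ->
        f n * dot (T y) (iota y) <= dot (T y) (T y)].

(** A subspace of dimension [n + 1] contains some nonzero [y] orthogonal to [u 0, ..., u (n - 1)].
    For it, extremality and the hypothesis combine to [f n |T y|^2 <= f n k <T y, y> <= k |T y|^2],
    and [T y] is nonzero. *)
Lemma pos_system_minmax T u f n (v : 'I_n.+1 -> H1) (k : R) :
  pos_system T u f -> (forall x, T x = 0 -> x = 0) -> 0 < k ->
  (forall c : 'I_n.+1 -> R, \sum_i c i *: v i = 0 -> forall i, c i = 0) ->
  (forall (c : 'I_n.+1 -> R) y, y = \sum_i c i *: v i ->
     dot (T y) (T y) <= k * dot (T y) (iota y)) ->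
  f n <= k.
Proof.
move=> [ou Tu ext] injT k0 indv vk.
pose C : 'M[R]_(n.+1, n) := \matrix_(j, i) dot (iota (v j)) (iota (u i)).
have [c c0 cC] := left_kernel C (ltnSn n).
set y := \sum_i c 0 i *: v i.
have y0 : y != 0.
  apply: contra c0 => /eqP y0; apply/eqP/rowP => i; rewrite mxE.
  exact: (indv (fun i => c 0 i)).
have py i : (i < n)%N -> dot (iota y) (iota (u i)) = 0.
  move=> ni; have /rowP/(_ (Ordinal ni)) := cC; rewrite !mxE => cCi.
  rewrite -[RHS]cCi bop_sumr dot_suml; apply: eq_bigr => j _.
  by rewrite (bopZr iota) dotZl mxE.
have D0 : 0 < dot (T y) (T y).
  by apply: dot_gt0; apply: contra y0 => /eqP/injT ->.
have := ext n y py; have := vk (fun i => c 0 i) y erefl.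
move: (dot (T y) (iota y)) (dot (T y) (T y)) D0 => q D D0 q1 q2.
have fn := growth_gt0 f n.
rewrite -(ler_pM2r D0); apply: (le_trans (y := f n * (k * q))).
  by rewrite ler_pM2l.
by rewrite mulrCA ler_pM2l.
Qed.

End Systems.

(** * Growth functions and the sizes of their level sets *)

Section GrowthFibers.
Variable R : realType.
Implicit Types f g : growth R.

(** By monotonicity a level set is an interval: from the first index with value at least [mu] to the
    first with value above [mu]. *)
Lemma growth_fiber f (mu : R) :
  exists p k : nat, forall n, (f n == mu) = (p <= n < p + k)%N.
Proof.
have fmono m n : (m <= n)%N -> f m <= f n by exact: growth_homo.
have exp : exists n, mu <= f n.
  by have [n /ltW] := growth_unbounded f mu; exists n.
have exq : exists n, mu < f n by exact: growth_unbounded.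
case: (ex_minnP exp) => p fp pmin; case: (ex_minnP exq) => q fq qmin.
have pq : (p <= q)%N by exact/pmin/ltW.
exists p, (q - p)%N => n; rewrite subnKC//.
apply/eqP/andP => [fn|[pn nq]].
  split; first by apply: pmin; rewrite fn.
  by rewrite ltnNge; apply: contraTN fq => /fmono; rewrite fn -leNgt.
apply/eqP; rewrite eq_le (le_trans fp (fmono _ _ pn)) andbT leNgt.
by apply/negP => /qmin; rewrite leqNgt nq.
Qed.

Lemma growth_fiber_card f (mu : R) p k :
  (forall n, (f n == mu) = (p <= n < p + k)%N) ->
  ([set n | f n = mu] #= `I_k)%card.
Proof.
move=> fk; have -> : [set n | f n = mu] = addn p @` `I_k.
  apply/seteqP; split=> [n /= /eqP|_ [i /= ik <-]].
    rewrite fk => /andP[pn nk]; exists (n - p)%N; last by rewrite subnKC.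
    by rewrite /= ltn_subLR.
  by apply/eqP; rewrite fk leq_addr ltn_add2l.
by apply: inj_card_eq => i j _ _ /addnI.
Qed.

(** At the first index [n] of disagreement, say with [f n < g n], the level set of [g] at [f n] lies
    below [n], hence inside that of [f], which contains [n] as well. Their sizes then differ. *)
Lemma growth_eq_of_fibers f g :
  (forall mu : R, 0 < mu -> exists2 k, ([set n | f n = mu] #= `I_k)%card &
    ([set n | g n = mu] #= `I_k)%card) ->
  forall n, f n = g n.
Proof.
move=> fg.
have same (mu : R) : 0 < mu -> exists p q k : nat,
    (forall n, (f n == mu) = (p <= n < p + k)%N) /\
    (forall n, (g n == mu) = (q <= n < q + k)%N).
  move=> mu0; have [k fk gk] := fg mu mu0.
  have [p [k1 fp]] := growth_fiber f mu; have [q [k2 gq]] := growth_fiber g mu.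
  have := card_eq_trans (card_esym fk) (growth_fiber_card fp).
  move/card_eq_II => kk1; rewrite -kk1 in fp.
  have := card_eq_trans (card_esym gk) (growth_fiber_card gq).
  move/card_eq_II => kk2; rewrite -kk2 in gq.
  by exists p, q, k.
elim/ltn_ind => n IH; apply/eqP.
wlog fg_n : f g fg same IH / f n < g n.
  move=> W; case: (ltgtP (f n) (g n)) => // fgn.
    by have := W f g fg same IH fgn; rewrite lt_eqF.
  have := W g f; rewrite eq_sym [f n == _]eq_sym lt_eqF//; apply => //.
  - by move=> mu /fg[k]; exists k.
  - by move=> mu /same[p [q [k [? ?]]]]; exists q, p, k.
  - by move=> m /IH.
have [p [q [k [fp gq]]]] := same _ (growth_gt0 f n).
have fn : (p <= n < p + k)%N by rewrite -fp.
have gn m : (n <= m)%N -> ~~ (q <= m < q + k)%N.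
  move=> nm; rewrite -gq gt_eqF// (lt_le_trans fg_n)//; exact: growth_homo.
have gf m : (q <= m < q + k)%N -> (p <= m < p + k)%N.
  move=> qm; have mn : (m < n)%N.
    by rewrite ltnNge; apply/negP => /gn/negP; apply.
  by rewrite -fp IH// gq.
have := gn n (leqnn n).
have k0 : (0 < k)%N by lia.
have := gf q; have := gf (q + k).-1; lia.
Qed.

End GrowthFibers.

(** * Positive eigensystems: existence and relation to the positive growth function *)

Section PositiveSystems.
Variables (R : realType) (h : growth R).

Local Notation H0 := (wl2 h 0).
Local Notation H1 := (wl2 h 1).
Local Notation iota := (iota10 h).
Local Notation dot := (@wl2_dot R h 0).
Implicit Types (T : bop H1 H0) (f g : growth R).
Local Opaque iota10.

Lemma pos_growth_uniq T f g :
  pos_growth T f -> pos_growth T g -> forall n, f n = g n.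
Proof.
move=> Tf Tg; apply: growth_eq_of_fibers => mu mu0.
have [k fk dk] := Tf mu mu0; have [k' gk' dk'] := Tg mu mu0.
exists k => //; suff -> : k = k' by [].
apply: has_dim_uniq dk dk'; change (T 0 = mu *: iota 0).
by rewrite (bop0r T) (bop0r iota) scaler0.
Qed.

(** The [u i] with [f i = mu] span the eigenspace: subtracting its projection from an eigenvector
    leaves an eigenvector [w] orthogonal to every [u n], by symmetry when [f n <> mu]. Extremality
    at some [n] with [f n > mu] gives [f n |w|^2 <= mu |w|^2], so [w = 0]. *)
Lemma pos_system_growth T u f : sym_op T -> pos_system T u f -> pos_growth T f.
Proof.
move=> symT [ou Tu ext] mu mu0.
have [p [k fk]] := growth_fiber f mu.
exists k; first exact: growth_fiber_card fk.
have fpk (i : 'I_k) : f (p + i)%N = mu.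
  by apply/eqP; rewrite fk leq_addr ltn_add2l ltn_ord.
pose e (i : 'I_k) := u (p + i)%N.
have oe i j : dot (iota (e i)) (iota (e j)) = (i == j)%:R.
  by rewrite ou eqn_add2l.
have Te i : T (e i) = mu *: iota (e i) by rewrite /e Tu fpk.
exists e; first exact: Te.
move=> x Tx; exists (\row_i dot (iota x) (iota (e i))).
have uniq (c : 'rV[R]_k) : x = \sum_i c 0 i *: e i ->
    c = \row_i dot (iota x) (iota (e i)).
  move=> xc; apply/rowP => i; rewrite mxE xc (iota_comb e (fun i => c 0 i)).
  by rewrite dot_orthonormal_coef.
split; last by move=> c /uniq.
under eq_bigr do rewrite mxE.
set z := \sum_i _; set w := x - z.
have iz : iota z = \sum_i dot (iota x) (iota (e i)) *: iota (e i).
  exact: iota_comb.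
have wE : T w = mu *: iota w.
  rewrite !bopBr Tx scalerBr; congr (_ - _).
  rewrite iz scaler_sumr bop_sumr; apply: eq_bigr => i _.
  by rewrite (bopZr T) Te scalerA mulrC -scalerA.
have wu n : dot (iota w) (iota (u n)) = 0.
  have [fn|fn] := boolP (f n == mu).
    have := fn; rewrite fk => /andP[pn npk].
    have nk : (n - p < k)%N by rewrite ltn_subLR.
    have -> : u n = e (Ordinal nk) by rewrite /e /= subnKC.
    by rewrite bopBr dotBl iz dot_orthonormal_coef// subrr.
  have := symT w (u n); rewrite wE Tu dotZl dotZr => /eqP.
  by rewrite -subr_eq0 -mulrBl mulf_eq0 subr_eq0 eq_sym (negbTE fn) => /eqP.
have [n mun] := growth_unbounded f mu.
apply/eqP; rewrite -subr_eq0 -/w -(iota_eq0 w); apply/eqP/dot_eq0.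
have := ext n w (fun i _ => wu i).
rewrite wE !dotZl !dotZr; set D := dot _ _ => le1.
have D0 : 0 <= D by exact: wl2_dot_ge0.
have : mu * (f n * D) <= mu * (mu * D) by move: le1; rewrite mulrCA.
rewrite ler_pM2l// => le2.
apply/eqP; rewrite eq_le D0 andbT -(@pmulr_rle0 _ (f n - mu)) ?subr_gt0//.
by rewrite mulrBl subr_le0.
Qed.

(** Starting from the empty list, an extremal eigenvector of [S] on the complement of the list is
    appended at each step, and [f n] is the inverse of its eigenvalue. The last hypothesis keeps the
    form positive somewhere on each complement, so the process never stops. *)
Lemma pos_system_exists T (S : bop H0 H1) :
  sym_op T -> cancel T S -> cancel S T ->
  (forall l : seq H1, exists2 y, perp l (iota y) & 0 < dot (T y) (iota y)) ->
  exists u f, pos_system T u f.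
Proof.
move=> symT TS ST posT.
have symS z w : dot (iota (S z)) w = dot z (iota (S w)).
  by rewrite -{1}(ST w) -symT ST.
pose good (l : seq H1) := forall a, a \in l -> exists2 k, k != 0 & T a = k *: iota a.
have goodS l a : good l -> a \in l -> exists k, S (iota a) = k *: a.
  move=> gl /gl[k k0 Ta]; exists k^-1.
  by apply: (can_inj TS); rewrite ST (bopZr T) Ta scalerA mulVf// scale1r.
have goodT l z : good l -> perp l (iota z) -> perp l (T z).
  by move=> gl pz a al; have [k _ Ta] := gl a al; rewrite symT Ta dotZr pz// mulr0.
pose next (l : seq H1) (us : H1 * R) := [/\ 0 < us.2, dot (iota us.1) (iota us.1) = 1,
  perp l (iota us.1), S (iota us.1) = us.2 *: us.1 &
  forall z, perp l z -> dot (iota (S z)) z <= us.2 * dot z z].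
have /choice[g gP] l : exists us, good l -> next l us.
  (* The pair [(0, 0)] is a placeholder for lists that are not [good]; all lists [L n] below are. *)
  have [gl|ngl] := pselect (good l); last by exists (0, 0).
  have [y py y0] := posT l.
  have [|u [s [s0 u1 pu Su ub]]] := extremal_eigenvector symS (fun a => goodS l a gl).
    by exists (T y); [exact: goodT|rewrite TS wl2_dotC].
  by exists (u, s).
pose L n := iter n (fun l => rcons l (g l).1) [::].
pose u n := (g (L n)).1; pose s n := (g (L n)).2.
have goodL n : good (L n).
  elim: n => [|n IH] a //; rewrite /= mem_rcons inE => /orP[/eqP->|/IH//].
  have [s0 _ _ Su _] := gP _ IH; exists (s n)^-1; first by rewrite invr_eq0 gt_eqF.
  rewrite -/(u n) -/(s n) in Su *; have -> : iota (u n) = s n *: T (u n).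
    by rewrite -(bopZr T) -Su ST.
  by rewrite scalerA mulVf ?scale1r// gt_eqF.
have uP n := gP _ (goodL n).
have s0 n : 0 < s n by have [] := uP n.
have Lu i n : (i < n)%N -> u i \in L n.
  elim: n => // n IH; rewrite ltnS leq_eqVlt /= mem_rcons inE.
  by case/orP => [/eqP->|/IH->]; rewrite ?eqxx ?orbT.
have LE n a : a \in L n -> exists2 i, (i < n)%N & a = u i.
  elim: n => [|n IH] //; rewrite /= mem_rcons inE => /orP[/eqP->|/IH[i ni ->]].
    by exists n.
  by exists i => //; exact: ltnW.
have u1 n : dot (iota (u n)) (iota (u n)) = 1 by have [] := uP n.
have Tu n : T (u n) = (s n)^-1 *: iota (u n).
  have [_ _ _ Su _] := uP n; rewrite -/(u n) -/(s n) in Su.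
  have -> : iota (u n) = s n *: T (u n) by rewrite -(bopZr T) -Su ST.
  by rewrite scalerA mulVf ?scale1r// gt_eqF.
have ult i j : (i < j)%N -> dot (iota (u j)) (iota (u i)) = 0.
  by move=> ij; have [_ _ pu _ _] := uP j; exact/pu/Lu.
have ou i j : dot (iota (u i)) (iota (u j)) = (i == j)%:R.
  case: (ltngtP i j) => [ij|ij|->]; last exact: u1.
    by rewrite wl2_dotC; exact: ult.
  exact: ult.
pose f n := (s n)^-1.
have f0 n : 0 < f n by rewrite invr_gt0.
have fmono : {homo f : m n / (m <= n)%N >-> m <= n}.
  apply: homo_leq => [//|? ? ?|n]; first exact: le_trans.
  (* The vector [u n.+1] is also admissible at step [n], so the suprema [s n] decrease. *)
  rewrite lef_pV2 ?posrE//; have [_ _ _ _ ub] := uP n.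
  have [_ _ pu Su _] := uP n.+1.
  have := ub (iota (u n.+1)); rewrite Su -/(u n.+1) -/(s n.+1) -/(s n).
  rewrite (bopZr iota) dotZl u1 !mulr1; apply => a al.
  by apply: pu; rewrite /= mem_rcons inE al orbT.
have funbounded (M : R) : exists n, M < f n.
  apply: contrapT => /forallNP fM.
  (* If [f] were bounded by [M], all [u i] would have [H1]-norm at most [opnorm S * M], although
     they are infinitely many and orthonormal in [H0]. *)
  have [B BP] := orthonormal_card h (opnorm S * M).
  suff : (B < B)%N by rewrite ltnn.
  apply: (BP B.+1 (fun i => u i)) => i; first by move=> j; rewrite ou.
  rewrite -(TS (u i)); apply: le_trans (opnorm_ub _ _) _.
  apply: ler_wpM2l; first exact: opnorm_ge0.
  have -> : `|T (u i)| = f i * `|iota (u i)|.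
    by rewrite Tu normrZ (gtr0_norm (f0 i)).
  have -> : `|iota (u i)| = 1.
    by apply/eqP; rewrite -(@eqrXn2 _ 2)// expr1n -dot_norm u1.
  by rewrite mulr1 leNgt; apply/negP/fM.
exists u, (Growth f0 fmono funbounded); split=> // n y py /=.
have [_ _ _ _ ub] := uP n; rewrite mulrC ler_pdivrMr//.
have := ub (T y); rewrite TS wl2_dotC mulrC; apply.
by apply: goodT; [exact: goodL|move=> a /LE[i ni ->]; exact: py].
Qed.

End PositiveSystems.

(** * Comparing positive eigensystems *)

Section GrowthTypeLemmas.
Variable R : realType.
Implicit Types f g k : growth R.

Lemma same_growthP f g : same_growth f g <->
  exists c, forall n, f n <= c * g n /\ g n <= c * f n.
Proof.
split=> [[c c0 fg]|[c fg]].
  exists c => n; have [gf fgn] := fg n; split=> //.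
  by rewrite -ler_pdivrMl.
have c0 : 0 < c.
  have [fg0 _] := fg 0%N.
  by rewrite -(pmulr_lgt0 _ (growth_gt0 g 0)) (lt_le_trans _ fg0)// growth_gt0.
exists c => // n; have [fgn gfn] := fg n; split=> //.
by rewrite ler_pdivrMl.
Qed.

Lemma same_growth_refl f : same_growth f f.
Proof. by apply/same_growthP; exists 1 => n; rewrite mul1r. Qed.

Lemma same_growth_sym f g : same_growth f g -> same_growth g f.
Proof.
move=> /same_growthP[c fg]; apply/same_growthP; exists c => n.
by have [] := fg n.
Qed.

Lemma same_growth_trans g f k :
  same_growth f g -> same_growth g k -> same_growth f k.
Proof.
move=> /same_growthP[c fg] /same_growthP[d gk]; apply/same_growthP.
have pos (u v : growth R) (e : R) : u 0%N <= e * v 0%N -> 0 <= e.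
  move: (growth_gt0 u 0) (growth_gt0 v 0) => u0 v0 uv.
  by rewrite -(pmulr_lge0 _ v0) (le_trans (ltW u0)).
have c0 : 0 <= c by have [/pos] := fg 0%N.
have d0 : 0 <= d by have [/pos] := gk 0%N.
exists (c * d) => n; have [fgn gfn] := fg n; have [gkn kgn] := gk n; split.
  by rewrite (le_trans fgn)// -mulrA ler_wpM2l.
by rewrite (le_trans kgn)// [c * d]mulrC -mulrA ler_wpM2l.
Qed.

Lemma eq_growth_same f g : (forall n, f n = g n) -> same_growth f g.
Proof.
by move=> fg; apply/same_growthP; exists 1 => n; rewrite !mul1r fg.
Qed.

Lemma growth_classP f g : growth_class f = growth_class g <-> same_growth f g.
Proof.
split=> [fg|fg].
  by have : growth_class g g := same_growth_refl g; rewrite -fg.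
apply/seteqP; split=> k /=; apply: same_growth_trans => //.
exact: same_growth_sym.
Qed.

(* All that survives of [same_growth] when [T] is replaced by [T + d iota],
   since finitely many eigenvalues may change sign. *)
Definition shift_dominated f g : Prop :=
  exists (C : R) (k : nat), forall n, f n <= C * g (n + k)%N.

(** Shift invariance gives [f (n + m) <= c ^+ m * f n], which absorbs any fixed shift into a
    constant; the finitely many indices below the shift are compared with [g 0]. *)
Lemma shift_dominated_same f g : same_growth f (Defs.shift f) ->
  shift_dominated f g -> shift_dominated g f -> same_growth f g.
Proof.
move=> /same_growthP[c fS] [C [k fg]] [D [l gf]].
have c0 : 0 < c.
  have [_ /= +] := fS 0%N; have := growth_gt0 f 1; have := growth_gt0 f 0.
  by move=> f0 f1 le1; rewrite -(pmulr_lgt0 _ f0) (lt_le_trans f1).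
have iter_shift n m : f (n + m)%N <= c ^+ m * f n.
  elim: m => [|m IH]; first by rewrite addn0 expr0 mul1r.
  rewrite addnS exprS -mulrA; have [_ /= +] := fS (n + m)%N.
  by move=> /le_trans; apply; rewrite ler_pM2l.
have C0 : 0 < C.
  have := fg 0%N; have := growth_gt0 f 0; have g0 := growth_gt0 g (0 + k).
  by move=> f0 le1; rewrite -(pmulr_lgt0 _ g0) (lt_le_trans f0).
have D0 : 0 < D.
  have := gf 0%N; have := growth_gt0 g 0; have g0 := growth_gt0 f (0 + l).
  by move=> f0 le1; rewrite -(pmulr_lgt0 _ g0) (lt_le_trans f0).
have g0 := growth_gt0 g 0; have f0 := growth_gt0 f 0.
have ck0 : 0 < c ^+ k by rewrite exprn_gt0.
(* [M1] bounds [f] by [g] for [n >= k], [M2] does so for [n < k], and [M3] bounds [g] by [f]. *)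
pose M1 := c ^+ k * C; pose M2 := c ^+ k * f 0%N / g 0%N; pose M3 := D * c ^+ l.
have M10 : 0 < M1 by rewrite mulr_gt0.
have M20 : 0 < M2 by rewrite divr_gt0// mulr_gt0.
have M30 : 0 < M3 by rewrite mulr_gt0// exprn_gt0.
apply/same_growthP; exists (M1 + M2 + M3) => n.
have gn := growth_gt0 g n; have fn := growth_gt0 f n; split.
  have [kn|nk] := leqP k n.
    apply: (@le_trans _ _ (M1 * g n)); last by rewrite ler_pM2r//; lra.
    rewrite -{1}(subnK kn) (le_trans (iter_shift _ _))// -mulrA ler_pM2l//.
    by rewrite -{2}(subnK kn).
  apply: (@le_trans _ _ (M2 * g n)); last by rewrite ler_pM2r//; lra.
  apply: (@le_trans _ _ (f (0 + k)%N)); first by apply: growth_homo; exact: ltnW.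
  rewrite (le_trans (iter_shift _ _))// /M2 -mulrA ler_peMr ?(ltW (mulr_gt0 ck0 f0))//.
  by rewrite ler_pdivlMl// mulr1; exact: growth_homo.
apply: (@le_trans _ _ (M3 * f n)); last by rewrite ler_pM2r//; lra.
by rewrite (le_trans (gf n))// -mulrA ler_pM2l.
Qed.

End GrowthTypeLemmas.

Section Comparison.
Variables (R : realType) (h : growth R).

Local Notation H0 := (wl2 h 0).
Local Notation H1 := (wl2 h 1).
Local Notation iota := (iota10 h).
Local Notation dot := (@wl2_dot R h 0).
Implicit Types (T E : bop H1 H0) (f g : growth R).
Local Opaque iota10.

(** Min-max for [T + d iota] is tested on the span of [u k, ..., u (n + k)], where [f k > |d|] makes
    all eigenvalues [f (i + k) + d] positive; they are at most [f (n + k) + |d|], hence at most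
    [(1 + |d| / f 0) f (n + k)]. *)
Lemma pos_system_translate T (d : R) u f u' f' :
  (forall x, (T + d *: iota) x = 0 -> x = 0) ->
  pos_system T u f -> pos_system (T + d *: iota) u' f' ->
  shift_dominated f' f.
Proof.
move=> injT' [ou Tu _] sys'; set T' := T + d *: iota.
have [k fk] := growth_unbounded f `|d|.
exists (1 + `|d| / f 0%N), k => n.
pose v (i : 'I_n.+1) := u (i + k)%N; pose mu (i : 'I_n.+1) := f (i + k)%N + d.
have ov i j : dot (iota (v i)) (iota (v j)) = (i == j)%:R.
  by rewrite ou eqn_add2r.
have Tv i : T' (v i) = mu i *: iota (v i).
  by rewrite /T' bopD bopZ Tu -scalerDl.
have mu0 i : 0 < mu i.
  have : f k <= f (i + k)%N by apply: growth_homo; rewrite leq_addl.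
  have := ler_norm (- d); rewrite normrN /mu; lra.
pose m := f (n + k)%N + `|d|.
have muM i : mu i <= m.
  apply: lerD; last exact: ler_norm.
  by apply: growth_homo; rewrite leq_add2r -ltnS.
apply: (@le_trans _ _ m); last first.
  rewrite mulrDl mul1r /m lerD2l -mulrA ler_peMr//.
  by rewrite ler_pdivlMl ?growth_gt0// mulr1; exact: growth_homo.
have m0 : 0 < m := lt_le_trans (mu0 ord0) (muM ord0).
apply: (pos_system_minmax sys' injT' m0 (v := v)) => [c|c y ->].
  exact: orthonormal_comb_eq0.
rewrite (dot_eigen_eigen c ov Tv) (dot_eigen_iota c ov Tv) mulr_sumr.
apply: ler_sum => i _; rewrite mulrA ler_wpM2r ?sqr_ge0// expr2 ler_pM2r//.
Qed.

(* A case of Heinz's inequality: otherwise the compression [K] of [- (E + T/2)]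
   to the span of the [u i] has an eigenvector [x] with eigenvalue [s > 0], and
   [|E x| >= |(s + T/2) x| > |T x| / 2]. *)
Lemma relative_form_bound T E u f n (c : 'I_n -> R) :
  sym_op E -> (forall x, `|E x| <= 2^-1 * `|T x|) ->
  (forall i j, dot (iota (u i)) (iota (u j)) = (i == j)%:R) ->
  (forall i, T (u i) = f i *: iota (u i)) ->
  - 2^-1 * dot (T (\sum_i c i *: u i)) (iota (\sum_i c i *: u i)) <=
  dot (E (\sum_i c i *: u i)) (iota (\sum_i c i *: u i)).
Proof.
move=> symE ET ou Tu; set y := \sum_i _; pose v (i : 'I_n) := u i.
have ov i j : dot (iota (v i)) (iota (v j)) = (i == j)%:R by exact: ou.
have Tv i : T (v i) = f i *: iota (v i) by exact: Tu.
(* The matrix of the form of [E + T/2] on the span, where [T] is diagonal with entries [f i]. *)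
pose w i j := dot (E (v i)) (iota (v j)) + (if i == j then f i / 2 else 0).
pose K : bop H0 H1 := - \sum_i \sum_j w i j *: rank1 (iota (v i)) (v j).
have KE z : K z = - \sum_i \sum_j (w i j * dot z (iota (v i))) *: v j.
  rewrite bopN bop_sum; congr (- _); apply: eq_bigr => i _.
  rewrite bop_sum; apply: eq_bigr => j _.
  by rewrite bopZ rank1E scalerA.
have wC i j : w i j = w j i.
  rewrite /w symE wl2_dotC eq_sym; congr (_ + _).
  by case: eqP => // ->.
have dotK z z' : dot (iota (K z)) z' =
    - \sum_i \sum_j w i j * dot z (iota (v i)) * dot z' (iota (v j)).
  rewrite KE (bopNr iota) dotNl bop_sumr dot_suml; congr (- _).
  apply: eq_bigr => i _; rewrite bop_sumr dot_suml; apply: eq_bigr => j _.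
  by rewrite (bopZr iota) dotZl [dot _ z']wl2_dotC.
have symK z z' : dot (iota (K z)) z' = dot z (iota (K z')).
  rewrite [RHS]wl2_dotC !dotK; congr (- _); rewrite exchange_big /=.
  apply: eq_bigr => j _; apply: eq_bigr => i _.
  by rewrite wC; ring.
have dotW (b : 'I_n -> R) j : forall x, x = \sum_i b i *: v i ->
    \sum_i w i j * b i = dot (E x) (iota (v j)) + 2^-1 * f j * b j.
  move=> x ->; rewrite bop_sumr dot_suml.
  under eq_bigr do rewrite /w mulrDl.
  rewrite big_split /=; congr (_ + _).
    by apply: eq_bigr => i _; rewrite (bopZr E) dotZl mulrC.
  rewrite (bigD1 j)//= eqxx big1 ?addr0 => [|i /negbTE ->]; last by rewrite mul0r.
  by rewrite [f j / 2]mulrC.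
have coef (b : 'I_n -> R) j : dot (iota (\sum_i b i *: v i)) (iota (v j)) = b j.
  by rewrite iota_comb dot_orthonormal_coef.
rewrite leNgt; apply/negP => neg.
have [||x [s [s0 x1 _ Kx _]]] := @extremal_eigenvector _ h K [::] symK.
- by [].
- exists (iota y) => //; rewrite dotK oppr_gt0 exchange_big /=.
  have -> : \sum_j \sum_i w i j * dot (iota y) (iota (v i))
      * dot (iota y) (iota (v j)) = dot (E y) (iota y)
      + 2^-1 * dot (T y) (iota y); last by lra.
  rewrite (dot_eigen_iota c ov Tv) [X in dot _ X]bop_sumr dot_sumr mulr_sumr.
  rewrite -big_split /=; apply: eq_bigr => j _.
  rewrite (coef c j) (bopZr iota) dotZr; under eq_bigr do rewrite (coef c).
  by rewrite -mulr_suml (dotW c j y erefl); ring.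
(* Since [K (iota x) = s *: x] with [s > 0], the vector [x] lies in the span of the [v j]; these are
   its coordinates. *)
pose b j := - s^-1 * \sum_i w i j * dot (iota x) (iota (v i)).
have xb : x = \sum_j b j *: v j.
  have -> : x = s^-1 *: K (iota x) by rewrite Kx scalerA mulVf ?scale1r// gt_eqF.
  rewrite KE exchange_big scalerN scaler_sumr -sumrN; apply: eq_bigr => j _.
  by rewrite -scaler_suml scalerA -scaleNr /b mulNr.
have Exv j : dot (E x) (iota (v j)) = - (s + f j / 2) * b j.
  have := dotW b j x xb.
  have -> : \sum_i w i j * b i = - s * b j.
    rewrite {2}/b mulrA mulrNN divff ?mul1r ?gt_eqF//.
    by apply: eq_bigr => i _; rewrite xb (coef b).
  by lra.
(* Bessel for [E x] bounds the left side by [|E x|^2]. The expansion [(s + f j / 2)^2 = s^2 + f j^2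
   / 4 + s f j] will show that the left side in fact exceeds the right by at least [s^2]. *)
have : \sum_(j < n) ((s + f j / 2) * b j) ^+ 2 <=
    2^-2 * \sum_(j < n) (f j) ^+ 2 * b j ^+ 2.
  rewrite -(dot_eigen_eigen b ov Tv) -xb.
  apply: (@le_trans _ _ (dot (E x) (E x))).
    apply: le_trans (bessel (E x) ov); rewrite le_eqVlt; apply/orP; left; apply/eqP.
    by apply: eq_bigr => j _; rewrite Exv mulNr sqrrN.
  have := ET x; rewrite -(@ler_pXn2r _ 2) ?nnegrE ?mulr_ge0//.
  by rewrite exprMn exprVn -(dot_norm (E x)) -(dot_norm (T x)).
have sb : \sum_j s ^+ 2 * b j ^+ 2 = s ^+ 2.
  have := x1; rewrite [in X in X = _ -> _]xb iota_comb dot_orthonormal// => b1.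
  rewrite -mulr_sumr -[RHS]mulr1 -[in RHS]b1; congr (_ * _).
have s20 : 0 < s ^+ 2 by rewrite exprn_gt0.
rewrite leNgt => /negP; apply.
apply: (@lt_le_trans _ _ (s ^+ 2 + 2^-2 * \sum_(j < n) (f j) ^+ 2 * b j ^+ 2)).
  by rewrite ltrDr.
rewrite -{1}sb mulr_sumr -big_split /=; apply: ler_sum => j _.
rewrite [2 ^- 2 * (_ * _)]mulrA -[leLHS]mulrDl [leRHS]exprMn ler_wpM2r ?sqr_ge0//.
have -> : (s + f j / 2) ^+ 2 = s ^+ 2 + 2^-2 * f j ^+ 2 + s * f j by field.
by rewrite lerDl mulr_ge0// ltW// growth_gt0.
Qed.

(** On the span of [u 0, ..., u n] one has [|(T + E) y|^2 <= 9/4 |T y|^2 <= 9/4 f n <T y, y>], while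
    the relative form bound gives [<(T + E) y, y> >= 1/2 <T y, y>]. The quotient of the two
    constants is [9/2], and min-max applies. *)
Lemma pos_system_perturb T E u f u' f' :
  sym_op E -> (forall x, `|E x| <= 2^-1 * `|T x|) ->
  (forall x, (T + E) x = 0 -> x = 0) ->
  pos_system T u f -> pos_system (T + E) u' f' ->
  forall n, f' n <= 9 / 2 * f n.
Proof.
move=> symE ET inj' [ou Tu _] sys' n.
pose v (i : 'I_n.+1) := u i.
have ov i j : dot (iota (v i)) (iota (v j)) = (i == j)%:R by exact: ou.
have Tv i : T (v i) = f i *: iota (v i) by exact: Tu.
have fn := growth_gt0 f n.
have k0 : 0 < 9 / 2 * f n by lra.
apply: (pos_system_minmax sys' inj' k0 (v := v)) => [c|c y yE].
  exact: orthonormal_comb_eq0.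
have := relative_form_bound c symE ET ou Tu; rewrite -[\sum_i _]yE.
have TT : dot (T y) (T y) <= f n * dot (T y) (iota y).
  rewrite yE (dot_eigen_eigen c ov Tv) (dot_eigen_iota c ov Tv) mulr_sumr.
  apply: ler_sum => i _; rewrite mulrA ler_wpM2r ?sqr_ge0// expr2.
  by rewrite ler_pM2r ?growth_gt0// growth_homo// -ltnS.
rewrite !bopD [X in _ <= _ * X]dotDl => lbE.
have TE : dot (T y + E y) (T y + E y) <= 9 / 4 * dot (T y) (T y).
  have TE1 : `|T y + E y| <= 3 / 2 * `|T y|.
    by have := ler_normD (T y) (E y); have := ET y; lra.
  rewrite !dot_norm (_ : 9 / 4 = (3 / 2) ^+ 2); last by field.
  by rewrite -exprMn ler_pXn2r ?nnegrE ?mulr_ge0//; lra.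
have : f n * (2^-1 * dot (T y) (iota y)) <=
    f n * (dot (T y) (iota y) + dot (E y) (iota y)).
  by rewrite ler_pM2l//; lra.
lra.
Qed.

End Comparison.

(** * Isomorphisms *)

Section Isomorphisms.
Variables (R : realType) (U V W : normedModType R).

Lemma comp_linear (S : bop V W) (T : bop U V) : linear (S \o T).
Proof. by move=> a x y /=; rewrite (bopDr T) (bopZr T) (bopDr S) (bopZr S). Qed.

Lemma comp_bounded (S : bop V W) (T : bop U V) :
  exists M : R, forall x, `|(S \o T) x| <= M * `|x|.
Proof.
exists (opnorm S * opnorm T) => x /=; rewrite -mulrA.
apply: le_trans (opnorm_ub _ _) _.
by apply: ler_wpM2l (opnorm_ub _ _); exact: opnorm_ge0.
Qed.

Definition bop_comp (S : bop V W) (T : bop U V) : bop U W :=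
  mkbop (@comp_linear S T) (comp_bounded S T).

Lemma section_linear (T : bop V W) (s : W -> V) :
  (forall x, T x = 0 -> x = 0) -> cancel s T -> cancel T s /\ linear s.
Proof.
move=> injT sP; have sT : cancel T s.
  by move=> x; apply/eqP; rewrite -subr_eq0; apply/eqP/injT; rewrite bopBr sP subrr.
by split=> // a x y; rewrite -{1}(sP x) -{1}(sP y) -(bopZr T) -(bopDr T) sT.
Qed.

Lemma isomorphism_of_bounded_below (T : bop V W) (c : R) :
  (forall x, `|x| <= c * `|T x|) -> (forall z, exists x, T x = z) ->
  isomorphism T.
Proof.
move=> Tc /choice[s sP].
have injT x : T x = 0 -> x = 0.
  move=> Tx; apply/eqP; rewrite -normr_le0; apply: le_trans (Tc x) _.
  by rewrite Tx normr0 mulr0.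
have [sT lin] := section_linear injT sP.
have bnd : exists M : R, forall z, `|s z| <= M * `|z|.
  by exists c => z; have := Tc (s z); rewrite sP.
by exists (mkbop lin bnd).
Qed.

End Isomorphisms.

Section Inverses.
Variables (R : realType) (h : growth R).

Local Notation H0 := (wl2 h 0).
Local Notation H1 := (wl2 h 1).
Local Notation iota := (iota10 h).
Local Notation dot := (@wl2_dot R h 0).
Implicit Types (T E : bop H1 H0).
Local Opaque iota10.

Lemma inverse_bound T (S : bop H0 H1) x : cancel T S -> `|x| <= opnorm S * `|T x|.
Proof. by move=> TS; rewrite -{1}(TS x); exact: opnorm_ub. Qed.

(** The estimate [|T x| <= 2 |(T + E) x|] bounds the inverse, and [T + E] hits [z] at [S p], where
    [p] is the fixed point of the contraction [x |-> z - E (S x)] of ratio 1/2. *)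
Lemma isomorphism_perturb T E : isomorphism T ->
  (forall x, `|E x| <= 2^-1 * `|T x|) -> isomorphism (T + E).
Proof.
move=> [S [TS ST]] ET.
apply: (@isomorphism_of_bounded_below _ _ _ _ (2 * opnorm S)) => [x|z].
  have := inverse_bound x TS; have := ET x; rewrite bopD => E1 S1.
  apply: le_trans S1 _; rewrite -mulrA mulrCA.
  apply: ler_wpM2l; first exact: opnorm_ge0.
  have := ler_normB (T x + E x) (E x); rewrite addrK; lra.
pose f x : H0 := z - E (S x).
have lip x y : `|f x - f y| <= 2^-1 * `|x - y|.
  have -> : f x - f y = E (S (y - x)).
    rewrite (bopBr S) (bopBr E) /f opprB addrC.
    exact: subrKA.
  by apply: le_trans (ET _) _; rewrite ST distrC.
have ff : set_fun [set: H0] [set: H0] f by [].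
have [|||p _ pE] := @banach_fixed_point R H0 [set: H0] (mkfun_fun ff).
- exists (2^-1)%:nng; split; first by rewrite /= invf_lt1// ltr1n.
  by move=> [x y] _; exact: lip.
- exact: closedT.
- by exists 0.
have {}pE : p = z - E (S p) := pE.
by exists (S p); rewrite bopD ST {1}pE subrK.
Qed.

Lemma sum_delta (F : nat -> R) n N :
  \sum_(0 <= m < N) F m * (m == n)%:R = if (n < N)%N then F n else 0.
Proof.
elim: N => [|N IH]; first by rewrite big_geq.
rewrite big_nat_recr//= IH ltnS [(n <= N)%N]leq_eqVlt [N == n]eq_sym.
by case: (ltngtP n N) => [_|_|->] /=; rewrite ?mulr0 ?mulr1 ?addr0 ?add0r.
Qed.

Lemma basis_vector_pred n : wl2_pred h 1 (fun m => (m == n)%:R : R^o).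
Proof.
apply: (@wl2_partial_pred _ _ _ _ (wt h 1 n)) => N.
have E (m : nat) : ((m == n)%:R : R) ^+ 2 = (m == n)%:R.
  by case: eqP; rewrite ?expr1n ?expr0n.
under eq_bigr do rewrite E; rewrite sum_delta.
by case: ifP => // _; exact/ltW/wt_gt0.
Qed.

Definition basis_vector n : H1 := Wl2 (basis_vector_pred n).

Lemma dot_basis_vector (x : H0) n : dot x (iota (basis_vector n)) = x n.
Proof.
apply: cvg_lim => //; apply: (@cvg_near_cst _ R^o).
exists n.+1 => // N /= nN; rewrite /series /=.
under eq_bigr do rewrite wt0 mul1r iotaE.
by rewrite sum_delta nN.
Qed.

(** A Hellinger-Toeplitz argument: by symmetry each coordinate of [s z] is an [H0]-product of [z]
    with a fixed vector, so the truncations [phi N] of [s] are bounded; they are pointwise dominated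
    by [|s z|], and Banach-Steinhaus bounds [s] itself. *)
Lemma isomorphism_of_bijective T : sym_op T ->
  (forall x, T x = 0 -> x = 0) -> (forall z, exists x, T x = z) ->
  isomorphism T.
Proof.
move=> symT injT surT; have [s sP] := choice surT.
have [sT lin] := section_linear injT sP.
have coord z n : s z n = dot z (iota (s (iota (basis_vector n)))).
  by rewrite -{2}(sP z) symT sP dot_basis_vector.
pose phi N : bop H0 H1 := \sum_(n < N)
  rank1 (iota (s (iota (basis_vector n)))) (basis_vector n).
have phiE N z n : phi N z n = if (n < N)%N then s z n else 0.
  rewrite bop_sum wl2_sum.
  under eq_bigr do rewrite rank1E -coord wl2Z /= eq_sym.
  by rewrite -(big_mkord xpredT (fun m => s z m * (m == n)%:R)) sum_delta.
have phi_le N z : `|phi N z| <= `|s z|.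
  apply: wl2_norm_le => // m; apply: le_trans (wl2_partial_le (s z) m).
  apply: ler_sum => n _; rewrite phiE.
  case: ifP => // _; rewrite expr0n mulr0.
  by rewrite mulr_ge0 ?sqr_ge0// ltW// wt_gt0.
have bounded : uniform_bounded [set (phi N : H0 -> H1) | N in [set: nat]].
  apply: Banach_Steinhauss => [_ [N _ <-]|z].
    split; last exact: bop_linear.
    move=> r; exists (opnorm (phi N) * `|r|) => x xr.
    apply: le_trans (opnorm_ub _ _) _.
    apply: ler_wpM2l; first exact: opnorm_ge0.
    exact: le_trans (ler_norm _).
  by exists `|s z| => _ [N _ <-]; exact: phi_le.
have [M MP] := bounded 1.
have M0 : 0 <= M.
  have := MP _ (ex_intro2 _ _ 0%N I erefl) 0; rewrite normr0 => /(_ ler01).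
  exact: le_trans.
have sM z : `|z| <= 1 -> `|s z| <= M.
  move=> z1; apply: wl2_norm_le => // N.
  apply: (@le_trans _ _ (\sum_(0 <= n < N) wt h 1 n * phi N z n ^+ 2)).
    by apply: ler_sum_nat => n /= nN; rewrite phiE nN.
  apply: le_trans (wl2_partial_le _ _) _.
  rewrite ler_pXn2r ?nnegrE//.
  by apply: (MP _ _ _ z1); exists N.
apply: (@isomorphism_of_bounded_below _ _ _ _ M) => // x.
have [->|x0] := eqVneq x 0; first by rewrite normr0 mulr_ge0.
have Tx : 0 < `|T x| by rewrite normr_gt0; apply: contra x0 => /eqP/injT ->.
have := sM (`|T x|^-1 *: T x).
rewrite -(bopZr T) sT !normrZ ger0_norm ?invr_ge0// => le1.
rewrite -ler_pdivrMr// mulrC; apply: le1.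
by rewrite (bopZr T) normrZ ger0_norm ?invr_ge0// mulVf// gt_eqF.
Qed.

End Inverses.

(** * A real number outside the spectrum of a symmetric Fredholm operator of index zero *)

Section RegularPoints.
Variables (R : realType) (h : growth R).

Local Notation H0 := (wl2 h 0).
Local Notation H1 := (wl2 h 1).
Local Notation iota := (iota10 h).
Local Notation dot := (@wl2_dot R h 0).
Implicit Types (A : bop H1 H0).
Local Opaque iota10.

Lemma square_mx_unit (F : fieldType) n (C : 'M[F]_n) :
  (forall a : 'rV[F]_n, a *m C = 0 -> a = 0) -> C \in unitmx.
Proof.
move=> injC; rewrite -row_free_unit; apply/row_freeP; apply: contrapT => nC.
have : kermx C == 0.
  apply/eqP/row_matrixP => i; rewrite row0; apply: injC.
  by rewrite -row_mul mulmx_ker row0.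
rewrite kermx_eq0 => /row_freeP; exact: nC.
Qed.

(** [iota P] is the [H0]-orthogonal projection onto the kernel, written with the inverse of the Gram
    matrix [G] of a basis; [G] is invertible because the basis is independent and [iota]
    injective. *)
Lemma kernel_projection A n : has_dim [set x | A x = 0] n ->
  exists P : bop H0 H1, (forall z, A (P z) = 0) /\
    forall z k, A k = 0 -> dot (z - iota (P z)) (iota k) = 0.
Proof.
move=> [e Ae eP]; pose G := \matrix_(i, j) dot (iota (e i)) (iota (e j)).
have indep (a : 'rV[R]_n) : \sum_i a 0 i *: e i = 0 -> a = 0.
  move=> a0; have [c [_ cu]] := eP 0 (bop0r A).
  rewrite -(cu a) ?a0//; apply: cu.
  by rewrite big1// => i _; rewrite mxE scale0r.
have Gu : G \in unitmx.
  apply: square_mx_unit => a aG; apply: indep.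
  apply/eqP; rewrite -(iota_eq0 (\sum_i _)); apply/eqP/dot_eq0.
  rewrite [X in dot _ X]bop_sumr dot_sumr big1// => j _.
  rewrite (bopZr iota) dotZr bop_sumr dot_suml.
  have /rowP/(_ j) := aG; rewrite !mxE => aGj.
  rewrite (_ : \sum_i _ = 0) ?mulr0// -[RHS]aGj.
  by apply: eq_bigr => i _; rewrite (bopZr iota) dotZl mxE.
pose P : bop H0 H1 :=
  \sum_i \sum_j invmx G i j *: rank1 (iota (e i)) (e j).
have PE z : P z = \sum_j (\sum_i dot z (iota (e i)) * invmx G i j) *: e j.
  rewrite bop_sum; under eq_bigr do rewrite bop_sum.
  rewrite exchange_big; apply: eq_bigr => j _; rewrite scaler_suml.
  by apply: eq_bigr => i _; rewrite bopZ rank1E scalerA mulrC.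
exists P; split=> [z|z k Ak].
  by rewrite PE bop_sumr big1// => j _; rewrite (bopZr A) Ae scaler0.
have [c [-> _]] := eP k Ak.
rewrite bop_sumr dot_sumr big1// => l _; rewrite (bopZr iota) dotZr.
rewrite dotBl PE bop_sumr dot_suml.
pose zr : 'rV[R]_n := \row_i dot z (iota (e i)).
have -> : \sum_j dot (iota ((\sum_i dot z (iota (e i)) * invmx G i j) *: e j))
    (iota (e l)) = (zr *m invmx G *m G) 0 l.
  rewrite mxE; apply: eq_bigr => j _; rewrite (bopZr iota) dotZl !mxE.
  by congr (_ * _); apply: eq_bigr => i _; rewrite mxE.
by rewrite -mulmxA mulVmx// mulmx1 mxE subrr mulr0.
Qed.

(** Index zero makes the kernel as large as the cokernel, so the classes of the kernel basis modulo
    the range form a square matrix [D]. By symmetry range and kernel are [H0]-orthogonal, hence meet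
    only in 0; so [D] is invertible and the kernel fills the cokernel. *)
Lemma range_kernel_span A : sym_op A -> fredholm_index A 0 ->
  exists n, has_dim [set x | A x = 0] n /\
    forall z, exists x k, A k = 0 /\ z = A x + iota k.
Proof.
move=> symA [m [n [dk _ [e eP]]]] /esym/eqP; rewrite subr_eq0 => /eqP[mn].
case: n / mn e eP => e eP; exists m; split => // z.
have [k Ak kP] := dk.
have /choice[C CP] i : exists c : 'rV[R]_m,
    range A (iota (k i) - \sum_j c 0 j *: e j).
  by have [c [cP _]] := eP (iota (k i)); exists c.
have indep (a : 'rV[R]_m) : \sum_i a 0 i *: k i = 0 -> a = 0.
  move=> a0; have [c [_ cu]] := kP 0 (bop0r A).
  rewrite -(cu a) ?a0//; apply: cu.
  by rewrite big1// => i _; rewrite mxE scale0r.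
pose D : 'M[R]_m := \matrix_(i, j) C i 0 j.
have comb (a : 'rV[R]_m) : exists x, A x =
    iota (\sum_i a 0 i *: k i) - \sum_j (a *m D) 0 j *: e j.
  have /choice[x xP] i : exists x, A x = iota (k i) - \sum_j C i 0 j *: e j.
    by have [x _ xP] := CP i; exists x.
  exists (\sum_i a 0 i *: x i).
  have aD : \sum_j (a *m D) 0 j *: e j
      = \sum_i a 0 i *: \sum_j C i 0 j *: e j.
    transitivity (\sum_i \sum_j a 0 i *: (C i 0 j *: e j)); last first.
      by apply: eq_bigr => i _; rewrite scaler_sumr.
    rewrite exchange_big; apply: eq_bigr => j _; rewrite mxE scaler_suml.
    by apply: eq_bigr => i _; rewrite mxE scalerA.
  rewrite [X in _ = _ - X]aD (bop_sumr A) (bop_sumr iota) -sumrB; apply: eq_bigr => i _.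
  by rewrite (bopZr A) xP scalerBr (bopZr iota).
have Aker (a : 'rV[R]_m) : A (\sum_i a 0 i *: k i) = 0.
  by rewrite bop_sumr big1// => i _; rewrite (bopZr A) Ak scaler0.
have Du : D \in unitmx.
  apply: square_mx_unit => a aD; apply: indep.
  have [x Ax] := comb a.
  apply/eqP; rewrite -(iota_eq0 (\sum_i _)); apply/eqP/dot_eq0.
  have {1}-> : iota (\sum_i a 0 i *: k i) = A x.
    rewrite Ax aD [X in _ - X]big1 ?subr0 => [//|j _].
    by rewrite mxE scale0r.
  by rewrite symA Aker dot0r.
have [c [[y _ Ay] _]] := eP z.
pose a := c *m invmx D; have [x Ax] := comb a.
exists (y - x), (\sum_i a 0 i *: k i); split; first exact: Aker.
by rewrite (bopBr A) Ay Ax /a mulmxKV// opprB addrA subrK subrK.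
Qed.

(** Adding the projection [Q] onto the kernel makes [A] an isomorphism [T0], and [T1 = T0 - l iota]
    remains one for small [l > 0]. On the kernel [T1] is [1 - l] and [A - l iota] is [- l], both
    nonzero; on its orthogonal complement the two operators agree. *)
Lemma fredholm_regular A : sym_op A -> fredholm_index A 0 ->
  exists l, isomorphism (A - l *: iota).
Proof.
move=> symA fA; have [n [dk span]] := range_kernel_span symA fA.
have [P [AP Pperp]] := kernel_projection dk.
have PK k : A k = 0 -> P (iota k) = k.
  move=> Ak; apply/esym/eqP; rewrite -subr_eq0 -(iota_eq0 (k - _)); apply/eqP.
  by apply: dot_eq0; rewrite {1}(bopBr iota) Pperp// (bopBr A) Ak AP subrr.
have Pdot z k : A k = 0 -> dot (iota (P z)) (iota k) = dot z (iota k).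
  by move=> Ak; have := Pperp z k Ak; rewrite dotBl; lra.
have Akdot x k : A k = 0 -> dot (A x) (iota k) = 0.
  by move=> Ak; rewrite symA Ak dot0r.
pose Q := bop_comp iota (bop_comp P iota).
have QE x : Q x = iota (P (iota x)) by [].
have symQ : sym_op Q.
  move=> x y; rewrite !QE.
  have Px := AP (iota x); have Py := AP (iota y).
  by rewrite wl2_dotC -(Pdot (iota y) _ Px) wl2_dotC (Pdot (iota x) _ Py).
have symiota (l : R) : sym_op (l *: iota).
  by move=> x y; rewrite !bopZ dotZl dotZr.
pose T0 := A + Q.
have T0E x : T0 x = A x + iota (P (iota x)) by [].
have symT0 : sym_op T0 by move=> x y; rewrite !bopD dotDl dotDr symA symQ.
have injT0 x : T0 x = 0 -> x = 0.
  move=> T0x; have Px : P (iota x) = 0.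
    apply/eqP; rewrite -(iota_eq0 (P _)); apply/eqP/dot_eq0.
    by rewrite -(add0r (dot _ _)) -{1}(Akdot x _ (AP (iota x))) -dotDl -T0E T0x dot0l.
  move: T0x; rewrite T0E Px bop0r addr0 => Ax.
  exact: etrans (esym (PK x Ax)) Px.
have surT0 z : exists x, T0 x = z.
  have [x [k [Ak ->]]] := span z; exists (x - P (iota x) + k); rewrite T0E.
  have -> : A (x - P (iota x) + k) = A x.
    by rewrite (bopDr A (x - P (iota x))) (bopBr A x) AP Ak subr0 addr0.
  have -> : P (iota (x - P (iota x) + k)) = k.
    rewrite (bopDr iota (x - P (iota x))) (bopBr iota x).
    rewrite (bopDr P (iota x - iota (P (iota x)))) (bopBr P (iota x)).
    by rewrite (PK _ (AP _)) (PK k Ak) subrr add0r.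
  by [].
have isoT0 := isomorphism_of_bijective symT0 injT0 surT0.
have [S0 [T0S _]] := isoT0.
pose B := opnorm iota * opnorm S0.
have B0 : 0 <= B by rewrite mulr_ge0 ?opnorm_ge0.
(* Small enough that [l iota] is at most half of [T0] in norm, and below 1 so that [1 - l] is
   nonzero. *)
pose l := (2 * (B + 1))^-1.
have l0 : 0 < l by rewrite invr_gt0; lra.
have lB : l * B <= 2^-1.
  by rewrite ler_pdivrMl ?mulr_gt0//; lra.
have l1 : l < 1 by rewrite invf_lt1; lra.
have small x : `|(- (l *: iota)) x| <= 2^-1 * `|T0 x|.
  rewrite bopN bopZ normrN normrZ (gtr0_norm l0).
  apply: (@le_trans _ _ (l * (B * `|T0 x|))); last first.
    by rewrite mulrA; apply: ler_wpM2r lB.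
  rewrite (ler_pM2l l0); apply: le_trans (opnorm_ub _ _) _.
  rewrite /B -mulrA; apply: ler_wpM2l; first exact: opnorm_ge0.
  exact: inverse_bound.
have [S1 [T1S ST1]] := isomorphism_perturb isoT0 small.
pose T1 := T0 + - (l *: iota).
have T1E x : T1 x = A x + iota (P (iota x)) - l *: iota x by [].
have injT1 x : T1 x = 0 -> x = 0.
  move=> T1x.
  exact: etrans (esym (T1S x)) (etrans (congr1 S1 T1x) (bop0r S1)).
exists l; apply: isomorphism_of_bijective.
- by move=> x y; rewrite !bopB dotBl dotBr symA symiota.
- move=> x Tx; have Px : P (iota x) = 0.
    set k := P (iota x).
    have Ak : A k = 0 by exact: AP.
    have : dot ((A - l *: iota) x) (iota k) = 0 by rewrite Tx dot0l.
    rewrite bopB bopZ dotBl dotZl (Akdot _ _ Ak) sub0r => /eqP.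
    rewrite oppr_eq0 mulf_eq0 (gt_eqF l0) => /eqP xk.
    apply/eqP; rewrite -(iota_eq0 k); apply/eqP/dot_eq0.
    by rewrite {1}/k Pdot.
  apply: injT1; rewrite T1E Px (bop0r iota) addr0.
  exact: Tx.
- move=> z; set w := S1 (z - iota (P z)).
  have T1w : T1 w = z - iota (P z) by exact: ST1.
  have Pw : P (iota w) = 0.
    set k := P (iota w).
    have Ak : A k = 0 by exact: AP.
    have wk : dot (iota k) (iota k) = dot (iota w) (iota k) by rewrite {1}/k Pdot.
    have : dot (T1 w) (iota k) = 0 by rewrite T1w Pperp.
    rewrite T1E dotBl dotDl dotZl (Akdot _ _ Ak) -/k wk => e0.
    apply/eqP; rewrite -(iota_eq0 k); apply/eqP/dot_eq0; rewrite wk.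
    have /eqP : (1 - l) * dot (iota w) (iota k) = 0.
      by rewrite -[RHS]e0; ring.
    have l1' : 0 < 1 - l by rewrite subr_gt0.
    by rewrite mulf_eq0 (gt_eqF l1') => /eqP.
  (* [w] solves the equation for the part of [z] orthogonal to the kernel; on the kernel
     [A - l iota] is multiplication by [- l], so the second term supplies [iota (P z)]. *)
  exists (w - l^-1 *: P z).
  have {}T1w : A w - l *: iota w = z - iota (P z).
    by have := T1w; rewrite T1E Pw (bop0r iota) addr0.
  have -> : (A - l *: iota) (w - l^-1 *: P z) =
      A w - l *: iota w - (l^-1 *: A (P z) - l *: (l^-1 *: iota (P z))).
    rewrite (bopBr (A - l *: iota) w); congr (_ - _).
    by rewrite bopB bopZ (bopZr A) (bopZr iota).
  rewrite T1w AP scaler0 sub0r opprK scalerA mulfV ?(gt_eqF l0)//.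
  by rewrite scale1r subrK.
Qed.

End RegularPoints.

(** * Local constancy of the growth types *)

Section LocalConstancy.
Variables (R : realType) (h : growth R).

Local Notation H0 := (wl2 h 0).
Local Notation H1 := (wl2 h 1).
Local Notation iota := (iota10 h).
Local Notation dot := (@wl2_dot R h 0).
Implicit Types (A B T E : bop H1 H0) (f g : growth R).
Local Opaque iota10.

Lemma sym_op_shift A (l : R) : sym_op A -> sym_op (A - l *: iota).
Proof.
by move=> symA x y; rewrite !bopB !bopZ dotBl dotBr dotZl dotZr symA.
Qed.

Lemma isomorphism_inj T : isomorphism T -> forall x, T x = 0 -> x = 0.
Proof.
move=> [S [TS _]] x Tx.
exact: etrans (esym (TS x)) (etrans (congr1 S Tx) (bop0r S)).
Qed.

Lemma eigen_sequence A (L : set R) : sym_op A -> infinite_set L ->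
  L `<=` Defs.eigenvalue A ->
  exists (v : nat -> H1) (mu : nat -> R), [/\ forall n, L (mu n),
    forall n, A (v n) = mu n *: iota (v n) &
    forall i j, dot (iota (v i)) (iota (v j)) = (i == j)%:R].
Proof.
move=> symA /infiniteP/pcard_leP[mu] Leig.
have Lmu n : L (mu n) by exact: funS.
have mu_inj : injective mu by move=> i j; apply: inj; rewrite inE.
have /choice[v vP] n : exists v, A v = mu n *: iota v /\ dot (iota v) (iota v) = 1.
  have [x x0 Ax] := Leig _ (Lmu n).
  exists (`|iota x|^-1 *: x); rewrite (bopZr iota); split.
    by rewrite (bopZr A) [A x]Ax !scalerA mulrC.
  by apply: dot_normalize; rewrite iota_eq0.
exists v, mu; split=> // [n|i j]; first by have [] := vP n.
have [<-|ij] := eqVneq i j; first by have [] := vP i.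
have [[Ai _] [Aj _]] := (vP i, vP j).
have := symA (v i) (v j); rewrite Ai Aj dotZl dotZr => /eqP.
rewrite -subr_eq0 -mulrBl mulf_eq0 subr_eq0 (inj_eq mu_inj) (negbTE ij) /=.
by move=> /eqP.
Qed.

(** Unit eigenvectors with eigenvalues bounded by [M] have [H1]-norm at most [opnorm S * (M + |l|)],
    and compactness limits the number of orthonormal ones. *)
Lemma eigenvalues_bounded_finite A (l M : R) : sym_op A ->
  isomorphism (A - l *: iota) ->
  finite_set [set mu | `|mu| <= M /\ Defs.eigenvalue A mu].
Proof.
move=> symA [S [TS _]]; apply: contrapT => inf.
have [|v [mu [muM Av ov]]] := eigen_sequence symA inf; first by move=> mu [].
have [N NP] := orthonormal_card h (opnorm S * (M + `|l|)).
suff : (N < N)%N by rewrite ltnn.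
apply: (NP N.+1 (fun i => v i)) => [i j|i]; first by rewrite ov.
apply: le_trans (inverse_bound (v i) TS) _.
apply: ler_wpM2l; first exact: opnorm_ge0.
have -> : (A - l *: iota) (v i) = (mu i - l) *: iota (v i).
  by rewrite bopB bopZ Av scalerBl.
have -> : `|(mu i - l) *: iota (v i)| = `|mu i - l|.
  have v1 : `|iota (v i)| = 1.
    by apply/eqP; rewrite -(@eqrXn2 _ 2)// expr1n -dot_norm ov eqxx.
  by rewrite normrZ v1 mulr1.
apply: le_trans (ler_normB _ _) _; apply: lerD => //.
by have [] := muM i.
Qed.

Definition infinitely_positive A : Prop :=
  infinite_set [set mu | 0 < mu /\ Defs.eigenvalue A mu].

(** Only finitely many positive eigenvalues of [A] are at most [l], so infinitely many exceed it.
    Among combinations of [size s + 1] of their eigenvectors a nonzero one is orthogonal to [s], and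
    the form of [A - l iota] is positive on it. *)
Lemma pos_system_regular A (l : R) : sym_op A -> infinitely_positive A ->
  isomorphism (A - l *: iota) -> exists u f, pos_system (A - l *: iota) u f.
Proof.
move=> symA infA isoT; have [S [TS ST]] := isoT.
apply: (pos_system_exists (sym_op_shift l symA) TS ST) => s.
have inf : infinite_set [set mu | l < mu /\ Defs.eigenvalue A mu].
  have fin := eigenvalues_bounded_finite `|l| symA isoT.
  apply: contra_not infA => fin'.
  have finU := conj fin fin'; rewrite -finite_setU in finU.
  apply: sub_finite_set finU => mu [mu0 eig].
  have [lmu|mul] := ltP l mu; [by right|left; split=> //].
  by rewrite gtr0_norm// (le_trans mul)// ler_norm.
have [|v [mu [muM Av ov]]] := eigen_sequence symA inf; first by move=> mu [].
pose n := size s.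
pose C : 'M[R]_(n.+1, n) :=
  \matrix_(j, i) dot (iota (v j)) (iota (nth 0 s i)).
have [c c0 cC] := left_kernel C (ltnSn n).
pose w (i : 'I_n.+1) := v i; exists (\sum_i c 0 i *: w i).
  move=> a /(nthP 0)[i ni <-].
  have /rowP/(_ (Ordinal ni)) := cC; rewrite !mxE => cCi.
  rewrite -[RHS]cCi bop_sumr dot_suml; apply: eq_bigr => j _.
  by rewrite (bopZr iota) dotZl mxE.
have ow i j : dot (iota (w i)) (iota (w j)) = (i == j)%:R by exact: ov.
have Tw i : (A - l *: iota) (w i) = (mu i - l) *: iota (w i).
  by rewrite bopB bopZ Av scalerBl.
rewrite (dot_eigen_iota (fun i => c 0 i) ow Tw).
have mu0 (i : 'I_n.+1) : 0 < mu i - l by rewrite subr_gt0; have [] := muM i.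
have [i ci] : exists i, c 0 i != 0.
  apply: contrapT => /forallNP c00; move/eqP: c0; apply.
  by apply/rowP => i; rewrite mxE; apply/eqP/negPn/negP/c00.
rewrite (bigD1 i)//= ltr_pwDl//.
  by rewrite mulr_gt0// lt_def sqr_ge0 sqrf_eq0 ci.
by apply: sumr_ge0 => j _; rewrite mulr_ge0 ?sqr_ge0// ltW.
Qed.

Lemma shift_invariant_same f g : same_growth f g ->
  same_growth f (Defs.shift f) -> same_growth g (Defs.shift g).
Proof.
move=> fg ff; apply: same_growth_trans (same_growth_sym fg) _.
apply: same_growth_trans ff _.
by have [c c0 fgc] := fg; exists c => // n; exact: fgc.
Qed.

Lemma shift_invariant_growth_class (c : set (growth R)) f :
  shift_invariant_growth_types R c -> growth_class f = c ->
  same_growth f (Defs.shift f).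
Proof.
move=> [g gS <-] /growth_classP fg.
exact: shift_invariant_same (same_growth_sym fg) gS.
Qed.

Definition has_pos_type A (l : R) (c : set (growth R)) : Prop :=
  exists2 f, pos_growth (A - l *: iota) f & growth_class f = c.

Lemma has_pos_type_system A l c u f : sym_op A ->
  pos_system (A - l *: iota) u f -> has_pos_type A l c -> growth_class f = c.
Proof.
move=> symA sys [g gA <-]; apply/growth_classP/eq_growth_same.
exact: pos_growth_uniq (pos_system_growth (sym_op_shift l symA) sys) gA.
Qed.

(** Translation by [l - l'] and back shows that each growth function dominates the other up to a
    shift, which the shift-invariant class [c] absorbs. *)
Lemma has_pos_type_translate A (l l' : R) c :
  sym_op A -> infinitely_positive A ->
  isomorphism (A - l *: iota) -> isomorphism (A - l' *: iota) ->
  shift_invariant_growth_types R c ->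
  has_pos_type A l c -> has_pos_type A l' c.
Proof.
move=> symA infA iso iso' cS Ac.
have [u [f sys]] := pos_system_regular symA infA iso.
have [u' [f' sys']] := pos_system_regular symA infA iso'.
have fc := has_pos_type_system symA sys Ac.
exists f'; first exact: pos_system_growth (sym_op_shift _ symA) sys'.
rewrite -fc; apply/growth_classP/same_growth_sym.
have dom (k k' : R) v g v' g' : isomorphism (A - k' *: iota) ->
    pos_system (A - k *: iota) v g -> pos_system (A - k' *: iota) v' g' ->
    shift_dominated g' g.
  have -> : A - k' *: iota = (A - k *: iota) + (k - k') *: iota.
    by rewrite scalerBl addrA subrK.
  move=> isok; apply: pos_system_translate; exact: isomorphism_inj.
apply: shift_dominated_same (dom _ _ _ _ _ _ iso sys' sys) (dom _ _ _ _ _ _ iso' sys sys').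
exact: shift_invariant_growth_class cS fc.
Qed.

Lemma has_pos_type_perturb A (l : R) : sym_op A -> infinitely_positive A ->
  isomorphism (A - l *: iota) ->
  exists2 e : R, 0 < e & forall B, sym_op B -> infinitely_positive B ->
    opnorm (B - A) < e -> isomorphism (B - l *: iota) /\
    forall c, has_pos_type A l c <-> has_pos_type B l c.
Proof.
move=> symA infA iso; have [S [TS _]] := iso.
pose N := opnorm S; have N0 : 0 <= N by exact: opnorm_ge0.
have e0 : 0 < (3 * (N + 1))^-1 by rewrite invr_gt0; lra.
exists (3 * (N + 1))^-1; first exact: e0.
move=> B symB infB BA.
set T := A - l *: iota in TS iso *; set T' := B - l *: iota.
pose E := B - A.
have T'E : T' = T + E by rewrite /T' /T /E [RHS]addrC addrA subrK.
have TE' : T = T' + - E by rewrite T'E addrK.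
(* The constant 1/3 leaves room for both directions: [|T' x| >= 2/3 |T x|], so [E] is at most half
   of [T] and also at most half of [T']. *)
have E3 x : `|E x| <= 3^-1 * `|T x|.
  apply: le_trans (opnorm_ub _ _) _.
  apply: (@le_trans _ _ ((3 * (N + 1))^-1 * (N * `|T x|))).
    apply: ler_pM; [exact: opnorm_ge0|exact: normr_ge0|exact: ltW|].
    exact: inverse_bound.
  rewrite mulrA; apply: ler_wpM2r => //.
  by rewrite ler_pdivrMl; lra.
have E2 x : `|E x| <= 2^-1 * `|T x|.
  by apply: le_trans (E3 x) _; apply: ler_wpM2r => //; lra.
have E2' x : `|(- E) x| <= 2^-1 * `|T' x|.
  rewrite bopN normrN; have := E3 x; rewrite {1}TE' bopD bopN => E3x.
  have := ler_normB (T' x) (E x); lra.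
have symE : sym_op E by move=> x y; rewrite !bopB dotBl dotBr symA symB.
have symE' : sym_op (- E) by move=> x y; rewrite !bopN dotNl dotNr symE.
have iso' : isomorphism T'.
  rewrite T'E.
  exact: isomorphism_perturb iso E2.
split; first exact: iso'.
move=> c; have [u [f sys]] := pos_system_regular symA infA iso.
have [u' [f' sys']] := pos_system_regular symB infB iso'.
have ff' : same_growth f f'.
  have inj' : forall x, (T + E) x = 0 -> x = 0.
    by rewrite -T'E; exact: isomorphism_inj iso'.
  have inj : forall x, (T' + - E) x = 0 -> x = 0.
    by rewrite -TE'; exact: isomorphism_inj iso.
  have sysE : pos_system (T + E) u' f' by rewrite -T'E; exact: sys'.
  have sysE' : pos_system (T' + - E) u f by rewrite -TE'; exact: sys.
  apply/same_growthP; exists (9 / 2) => n; split.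
    exact: pos_system_perturb symE' E2' inj sys' sysE' n.
  exact: pos_system_perturb symE E2 inj' sys sysE n.
split=> [/(has_pos_type_system symA sys) <-|/(has_pos_type_system symB sys') <-].
  exists f'; first exact: pos_system_growth (sym_op_shift _ symB) sys'.
  by apply/growth_classP/same_growth_sym.
exists f; first exact: pos_system_growth (sym_op_shift _ symA) sys.
exact/growth_classP.
Qed.

End LocalConstancy.

(** * Floer type Hessians: both signs of the spectrum *)

Section Floer.
Variables (R : realType) (h : growth R).

Local Notation H0 := (wl2 h 0).
Local Notation H1 := (wl2 h 1).
Local Notation H2 := (wl2 h 2).
Local Notation iota := (iota10 h).
Local Notation L10xL21 := (bop H1 H0 * bop H2 H1)%type.
Implicit Types (T : bop H1 H0) (f : growth R).
Local Opaque iota10.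

Lemma isomorphism_opp T : isomorphism T -> isomorphism (- T).
Proof.
move=> [S [TS ST]]; exists (- S); split=> x.
  by rewrite !bopN (bopNr S) opprK TS.
by rewrite !bopN (bopNr T) opprK ST.
Qed.

Lemma eigenspace_opp T (l : R) : Defs.eigenspace (- T) l = Defs.eigenspace T (- l).
Proof.
apply/seteqP; split=> x; rewrite /Defs.eigenspace /mkset bopN scaleNr.
  by move=> <-; rewrite opprK.
by move=> ->; rewrite opprK.
Qed.

Lemma neg_growthE T f : neg_growth T f <-> pos_growth (- T) f.
Proof.
by split=> Tf mu /Tf[k fk dk]; exists k => //; move: dk; rewrite eigenspace_opp.
Qed.

Lemma opp_shift T (l : R) : - (T - l *: iota) = - T - - l *: iota.
Proof. by rewrite opprB scaleNr opprK addrC. Qed.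

Lemma has_neg_type T (l : R) (c : set (growth R)) :
  (exists2 f, neg_growth (T - l *: iota) f & growth_class f = c) <->
  has_pos_type (- T) (- l) c.
Proof.
rewrite /has_pos_type -opp_shift.
by split=> -[f Tf fc]; exists f => //; exact/neg_growthE.
Qed.

Lemma sym_op_opp T : sym_op T -> sym_op (- T).
Proof. by move=> symT x y; rewrite !bopN dotNl dotNr symT. Qed.

Lemma floer_infinitely_positive (A : L10xL21) : floer h A ->
  [/\ sym_op A.1, fredholm_index A.1 0, infinitely_positive A.1 &
    infinitely_positive (- A.1)].
Proof.
move=> [[_ symA fA _] posA negA]; split=> //.
apply: contra_not negA => fin.
apply: sub_finite_set (finite_image (-%R : R -> R) fin) => l [l0 [x x0 Ax]].
exists (- l); last exact: opprK.
split; first by rewrite oppr_gt0.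
by exists x => //; rewrite eigenspace_opp opprK.
Qed.

(** Reduces the condition over all regular values to one value [l], since types are preserved by
    translation; the negative type of [A] at [l] is the positive type of [- A] at [- l]. *)
Lemma floer_ab_regular (A : L10xL21) (l : R) (a b : set (growth R)) :
  shift_invariant_growth_types R a -> shift_invariant_growth_types R b ->
  floer h A -> isomorphism (A.1 - l *: iota) ->
  floer_ab h a b A <-> has_pos_type (- A.1) (- l) a /\ has_pos_type A.1 l b.
Proof.
move=> aS bS FA iso; have [symA _ posA negA] := floer_infinitely_positive FA.
have iso_opp k : isomorphism (A.1 - k *: iota) ->
    isomorphism (- A.1 - - k *: iota).
  by rewrite -opp_shift; exact: isomorphism_opp.
split=> [[_ ab]|[Aa Ab]].
  by have [] := ab l (fun nl => nl iso); rewrite has_neg_type.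
split; first exact: FA.
move=> k /contrapT isok; rewrite has_neg_type; split.
  exact: has_pos_type_translate (sym_op_opp symA) negA (iso_opp _ iso)
    (iso_opp _ isok) aS Aa.
exact: has_pos_type_translate symA posA iso isok bS Ab.
Qed.

(** One [l] regular for [A] stays regular for nearby [B], so membership of both is decided at the
    same [l], where positive and negative types agree. *)
Lemma floer_ab_locally_constant (A : L10xL21) (a b : set (growth R)) :
  shift_invariant_growth_types R a -> shift_invariant_growth_types R b ->
  floer h A ->
  exists2 e : R, 0 < e & forall B, floer h B -> opnorm (B.1 - A.1) < e ->
    floer_ab h a b A <-> floer_ab h a b B.
Proof.
move=> aS bS FA; have [symA fA posA negA] := floer_infinitely_positive FA.
have [l iso] := fredholm_regular symA fA.
have [e e0 eP] := has_pos_type_perturb symA posA iso.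
have iso_opp : isomorphism (- A.1 - - l *: iota).
  by rewrite -opp_shift; exact: isomorphism_opp.
have [d d0 dP] := has_pos_type_perturb (sym_op_opp symA) negA iso_opp.
exists (Num.min e d); first by rewrite lt_min e0.
move=> B FB; rewrite lt_min => /andP[Be Bd].
have [symB fB posB negB] := floer_infinitely_positive FB.
have [isoB posE] := eP B.1 symB posB Be.
have Bd' : opnorm (- B.1 - - A.1) < d.
  have -> : - B.1 - - A.1 = - (B.1 - A.1) by rewrite opprB opprK addrC.
  by rewrite -scaleN1r opnormZ normrN1 mul1r.
have [_ negE] := dP (- B.1) (sym_op_opp symB) negB Bd'.
by rewrite (floer_ab_regular aS bS FA iso) (floer_ab_regular aS bS FB isoB)
  posE negE.
Qed.

End Floer.

(** * Passage from local constancy to the subspace topology *)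

Lemma locally_constant_clopen (R : realType) (V : normedModType R) (F : set V)
    (P : V -> Prop) :
  (forall A, F A -> exists2 e : R, 0 < e &
    forall B, F B -> `|B - A| < e -> P A <-> P B) ->
  clopen [set A : F | P (set_val A)].
Proof.
move=> loc; have op (Q : V -> Prop) :
    (forall A, F A -> exists2 e : R, 0 < e &
      forall B, F B -> `|B - A| < e -> Q A -> Q B) ->
    open [set A : F | Q (set_val A)].
  move=> locQ; rewrite openE => A QA.
  have [e e0 eP] := locQ _ (set_valP A).
  have nb : nbhs A [set B : F | ball (set_val A) e (set_val B)].
    exact: (@initial_continuous F V set_val A _ (nbhsx_ballx (set_val A) e e0)).
  apply: filterS nb => B; rewrite /= -ball_normE /ball_ /= distrC => BA.
  exact: eP (set_valP B) BA QA.
split; first by apply: op => A /loc[e e0 eP]; exists e => // B FB /(eP B FB)[].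
rewrite -[X in closed X]setCK; apply: open_closedC.
(* The local equivalence of [P A] and [P B] also transports the negation, so the complement is
   open. *)
apply: (op (fun A => ~ P A)) => A /loc[e e0 eP]; exists e => // B FB BA nPA PB.
by apply: nPA; have [_] := eP B FB BA; apply.
Qed.

Theorem theoremA (R : realType) (h : growth R) (a b : set (growth R))
    (ha : shift_invariant_growth_types R a)
    (hb : shift_invariant_growth_types R b) :
  clopen [set A : floer h | floer_ab h a b (set_val A)].
Proof.
apply: locally_constant_clopen => A FA.
have [e e0 eP] := floer_ab_locally_constant ha hb FA.
exists e; first exact: e0.
move=> B FB BA; apply: eP; first exact: FB.
(* The product norm is a maximum, so it dominates the operator norm of the first component. *)
by apply: le_lt_trans BA; rewrite prod_normE le_max lexx.
Qed.
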